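(* For a ring $R$, the following conditions are equivalent: (1) the graph $G(R)$ is infinite and $R$ contains a maximal left ideal $T$ satisfying $\deg(T)<|G(R)|$; (2) up to isomorphism, $R$ is one of the following rings: (i) $R=M_2(\Delta)$, the ring of all $2\times 2$ matrices over an infinite division ring $\Delta$. In this case $T$ can be any nontrivial left ideal of $R$, and $\deg(T)=0$; (ii) $R=\begin{pmatrix}\Delta&\Delta\\0&P\end{pmatrix}\subseteq M_2(\Delta)$, where $P$ is a subring of an infinite division ring $\Delta$ such that the cardinality of the set of left ideals of $P$ is smaller than $|\Delta|$. In this case $T=\begin{pmatrix}0&\Delta\\0&P\end{pmatrix}$ is the unique maximal left ideal of $R$. Moreover, $R$ contains a maximal left ideal $T$ of finite degree and $G(R)$ is infinite if and only if either $R$ is as in (2)(i) (so $\deg(T)=0$) or $R$ is as in (2)(ii) and $P$ is a division subring of $\Delta$ (then $\deg(T)=2$).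
   Context: Rings are associative with unity $1$. A left ideal of $R$ is nontrivial if it is different from $0$ and $R$. The intersection graph $G(R)$ is the simple graph whose vertices are the nontrivial left ideals of $R$, two distinct vertices being adjacent iff their intersection is nonzero; $|G(R)|$ is the cardinality of its vertex set, and $G(R)$ is infinite if this cardinality is infinite. For a nontrivial left ideal $T$, $\deg(T)$ is the cardinality of the set of all nontrivial left ideals $K\neq T$ of $R$ with $T\cap K\neq 0$ (the degree of $T$ in $G(R)$).
   Formalization: In (2)(ii), T is proved to be the unique maximal left ideal with deg(T)<|G(R)|, not the unique maximal left ideal of R, which is false: the left ideal of matrices with first row in Δ and second row (0, M), M a maximal left ideal of P, is also maximal. *)

(* Defs.v *)
From HB Require Import structures.
From mathcomp Require Import all_boot all_algebra.
From mathcomp Require Import boolp classical_sets functions cardinality.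

Set Implicit Arguments.
Unset Strict Implicit.
Unset Printing Implicit Defensive.

Import GRing.Theory.

Local Open Scope classical_set_scope.
Local Open Scope ring_scope.
Local Open Scope card_scope.

Definition card_lt T U (A : set T) (B : set U) : Prop :=
  A #<= B /\ ~ (B #<= A).

(* Left ideals are the submodules of the left regular module R^o. *)
Definition left_ideals (R : pzRingType) : set (set R) :=
  [set I | submod_closed ([in I] : {pred R^o})].
Arguments left_ideals R : clear implicits.

Definition maximal_left_ideal (R : pzRingType) (T : set R) : Prop :=
  [/\ left_ideals R T, T <> setT &
      forall J, left_ideals R J -> T `<=` J -> J = T \/ J = setT].

(* The intersection graph G(R): vertices, adjacency and neighbourhoods; the
   cardinals |G(R)| and deg T are those of the sets [graph_vertices R] and
   [neighbours T]. *)
Definition graph_vertices (R : pzRingType) : set (set R) :=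
  [set I | [/\ left_ideals R I, I <> [set 0] & I <> setT]].
Arguments graph_vertices R : clear implicits.

Definition graph_adj (R : pzRingType) (I J : set R) : Prop :=
  I <> J /\ I `&` J <> [set 0].

Definition neighbours (R : pzRingType) (T : set R) : set (set R) :=
  [set K | graph_vertices R K /\ graph_adj T K].

Definition small_degree (R : pzRingType) (T : set R) : Prop :=
  card_lt (neighbours T) (graph_vertices R).

Definition division_ring (D : nzRingType) : Prop :=
  forall x : D, x != 0 -> exists y : D, y * x = 1 /\ x * y = 1.

Definition infinite_division_ring (D : nzRingType) : Prop :=
  division_ring D /\ infinite_set [set: D].

Definition ring_isomorphic (R S : pzRingType) : Prop :=
  exists f : {rmorphism R -> S}, bijective f.

Definition subring (A : nzRingType) (P : subringClosed A) : Type :=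
  {x : A | x \in P}.

HB.instance Definition _ (A : nzRingType) (P : subringClosed A) :=
  [isSub of subring P for @sval A (fun x => x \in P)].
HB.instance Definition _ (A : nzRingType) (P : subringClosed A) :=
  [Choice of subring P by <:].
HB.instance Definition _ (A : nzRingType) (P : subringClosed A) :=
  [SubChoice_isSubNzRing of subring P by <:].

Section Triangular.
Variables (D : nzRingType) (P : subringClosed D).

Definition triangular : {pred 'M[D]_2} :=
  [pred A : 'M[D]_2 | (A 1 0 == 0) && (A 1 1 \in P)].

Fact triangular_subring_closed : subring_closed triangular.
Proof.
split.
- by rewrite inE !mxE /= eqxx rpred1.
- move=> A B; rewrite !inE => /andP[/eqP A0 A1] /andP[/eqP B0 B1].
  by rewrite !mxE A0 B0 subrr eqxx rpredB.
- move=> A B; rewrite !inE => /andP[/eqP A0 A1] /andP[/eqP B0 B1].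
  rewrite !mxE !big_ord_recl !big_ord0 /= !addr0.
  have -> : lift ord0 ord0 = 1 :> 'I_2 by apply/val_inj.
  by rewrite A0 B0 !mul0r mulr0 !add0r eqxx rpredM.
Qed.

HB.instance Definition _ :=
  GRing.isSubringClosed.Build 'M[D]_2 triangular triangular_subring_closed.

(* The ring of matrices ((D, D), (0, P)). *)
Definition triangular_ring : nzRingType := subring triangular.

(* The left ideal ((0, D), (0, P)). *)
Definition triangular_ideal : set triangular_ring :=
  [set A | (\val A : 'M[D]_2) 0 0 = 0].

End Triangular.
Arguments triangular_ring {D} P.
Arguments triangular_ideal {D} P.

Definition triangular_data (D : nzRingType) (P : subringClosed D) : Prop :=
  infinite_division_ring D /\ card_lt (left_ideals (subring P)) [set: D].

(* Main.v *)
(* Let T be a maximal left ideal.  A nontrivial left ideal other than T and not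
   adjacent to T is a complement of T; if one exists then R = T + Re with e an
   idempotent, T = {x | xe = 0}, Re is simple, D = eRe is a division ring, and
   the complements are the R(e + c) with c in V = eR(1 - e).  When G(R) is
   infinite and deg(T) < |G(R)|, cardinal arithmetic gives deg(T) < |V|.

   For a nonzero left ideal L strictly inside T, the left ideals L + R(e + c)
   are neighbours of T, and they determine L and the class of c modulo L.
   Counting them shows that V = Da is a line over D.  If T = Ra then R has a
   system of 2 x 2 matrix units.  Otherwise every nonzero left ideal inside T
   contains a, which forces (1 - e)Re = 0 and makes the right action of
   (1 - e)R(1 - e) on V faithful; that action identifies (1 - e)R(1 - e) with a
   subring P of D, and R with the triangular ring.

   Conversely, the neighbours of T in the triangular ring are the left ideals
   other than T and R that contain the entry (0, 1): they are described by a
   left ideal of P and one bit, so there are fewer than |D| of them.  A maximal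
   left ideal other than T meets every nonzero left ideal, so its degree is
   |G(R)|. *)

From HB Require Import structures.
Require Import Defs.
From mathcomp Require Import all_boot all_algebra.
From mathcomp Require Import boolp classical_sets functions cardinality.

Set Implicit Arguments.
Unset Strict Implicit.
Unset Printing Implicit Defensive.

Import GRing.Theory.

Local Open Scope classical_set_scope.
Local Open Scope ring_scope.
Local Open Scope card_scope.

(** * Cardinals *)

Lemma card_le_relP T U (A : set T) (B : set U) :
  A #<= B <-> exists r : T -> U -> Prop,
    (forall x, A x -> exists2 y, B y & r x y) /\
    (forall x x' y, A x -> A x' -> r x y -> r x' y -> x = x').
Proof.
split=> [/card_leP[f]|[r [rA rI]]].
  exists (fun x y => exists Ax : x \in A, val (f (exist _ x Ax)) = y); split.
    move=> x /mem_set Ax; exists (val (f (exist _ x Ax))); last by exists Ax.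
    by apply: set_mem; exact: valP.
  move=> x x' y _ _ [Ax <-] [Ax' /val_inj /esym/(@inj _ _ _ f)].
  by move=> /(_ (mem_set I) (mem_set I)) [].
have [->|/set0P[x0 /rA[u0 _ _]]] := eqVneq A set0; first exact: card_ge0.
have /choice[f fP] : forall x, exists y, A x -> B y /\ r x y.
  move=> x; have [/rA[y By rxy]|nAx] := pselect (A x); first by exists y.
  by exists u0.
have fI : {in A &, injective f}.
  move=> x x' /set_mem Ax /set_mem Ax' fxx'.
  apply: (rI _ _ (f x)) => //; first exact: (fP x Ax).2.
  by rewrite fxx'; exact: (fP x' Ax').2.
rewrite -(card_le_eql (inj_card_eq fI)); apply: subset_card_le => _ [x /fP[Bx _] <-].
exact: Bx.
Qed.

Lemma card_le_inj T U (A : set T) (B : set U) (f : T -> U) :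
  (forall x, A x -> B (f x)) ->
  (forall x x', A x -> A x' -> f x = f x' -> x = x') -> A #<= B.
Proof.
move=> fB fI; apply/card_le_relP; exists (fun x y => f x = y); split.
  by move=> x Ax; exists (f x) => //; exact: fB.
by move=> x x' y Ax Ax' fx fx'; apply: fI; rewrite ?fx.
Qed.

Lemma card_le_comparable T U (A : set T) (B : set U) : A #<= B \/ B #<= A.
Proof.
pose P : set (set (T * U)) := [set G |
  G `<=` A `*` B /\ forall p q, G p -> G q -> p.1 = q.1 \/ p.2 = q.2 -> p = q].
have [F FP Ftot|G [[GAB GI] Gmax]] := @Zorn_bigcup _ P.
  split=> [p [G FG Gp]|p q [G FG Gp] [H FH Hq] pq]; first exact: (FP G FG).1.
  have [GH|HG] := Ftot _ _ FG FH.
    by apply: (FP H FH).2 => //; exact: GH.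
  by apply: (FP G FG).2 => //; exact: HG.
have [domG|/existsNP[x /not_implyP[Ax nGx]]] :=
    pselect (forall x, A x -> exists y, G (x, y)).
  left; apply/card_le_relP; exists (fun x y => G (x, y)); split.
    by move=> x /domG[y Gxy]; exists y => //; exact: (GAB _ Gxy).2.
  by move=> x x' y _ _ Gxy Gx'y; have [] := GI _ _ Gxy Gx'y (or_intror erefl).
have [ranG|/existsNP[y /not_implyP[By nGy]]] :=
    pselect (forall y, B y -> exists x, G (x, y)).
  right; apply/card_le_relP; exists (fun y x => G (x, y)); split.
    by move=> y /ranG[x' Gxy]; exists x' => //; exact: (GAB _ Gxy).1.
  by move=> y y' x' _ _ Gxy Gx'y; have [] := GI _ _ Gxy Gx'y (or_introl erefl).
exfalso; apply: (Gmax (G `|` [set (x, y)])).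
  split; first by move=> p Gp; left.
  by move=> /(_ (x, y) (or_intror erefl)) Gxy; apply: nGx; exists y.
split=> [p [/GAB//|->//]|[x1 y1] [x2 y2] /= Gp Gq pq].
case: Gp Gq pq => [G1|[-> ->]] [G2|[-> ->]] //.
- exact: (GI _ _ G1 G2).
- by case=> eq; subst; [case: nGx; exists y1|case: nGy; exists x1].
- by case=> eq; subst; [case: nGx; exists y2|case: nGy; exists x2].
Qed.

Lemma infinite_card_le_setX_bool T (X : set T) :
  infinite_set X -> X `*` [set: bool] #<= X.
Proof.
move=> Xinf.
pose P : set (set (set T)) := [set F |
  (forall M, F M -> M `<=` X /\ M #= [set: nat]) /\
  forall M N x, F M -> F N -> M x -> N x -> M = N].
have [C CP Ctot|F [[FX Fdisj] Fmax]] := @Zorn_bigcup _ P.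
  split=> [M [F CF FM]|M N x [F CF FM] [G CG GN]]; first exact: (CP F CF).1.
  have [FG|GF] := Ctot _ _ CF CG.
    by apply: (CP G CG).2 => //; exact: FG.
  by apply: (CP F CF).2 => //; exact: GF.
pose U := \bigcup_(M in F) M.
have Ufin : finite_set (X `\` U).
  apply: contrapT => /infiniteP/card_le_relP[r [rX rI]].
  have /choice[g gP] : forall n : nat, exists y, (X `\` U) y /\ r n y.
    by move=> n; have [//|y Xy rny] := rX n; exists y.
  have gI : {in [set: nat] &, injective g}.
    move=> m n _ _ gmn; apply: (rI _ _ (g m)) => //; first exact: (gP m).2.
    by rewrite gmn; exact: (gP n).2.
  pose M0 := range g.
  apply: (Fmax (F `|` [set M0])).
    split; first by move=> M FM; left.
    move=> /(_ M0 (or_intror erefl)) FM0; have [[_ +] _] := gP 0%N; apply.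
    by exists M0 => //; exists 0%N.
  have M0U M x : F M -> M x -> M0 x -> False.
    by move=> FM Mx [n _ gn]; have [[_ +] _] := gP n; apply; exists M; rewrite ?gn.
  split=> [M [/FX//|->]|M N x [FM|->] [FN|->] Mx Nx //].
    by split; [move=> _ [n _ <-]; have [[]] := gP n|exact: inj_card_eq].
  - exact: Fdisj Mx Nx.
  - by case: (M0U M x).
  - by case: (M0U N x).
have Uinf : infinite_set U.
  move=> finU; apply: Xinf; have : finite_set (U `|` (X `\` U)) by rewrite finite_setU.
  by apply: sub_finite_set => x Xx; have [|] := pselect (U x); [left|right].
have UU : U `*` [set: bool] #<= U.
  have /choice[r rP] : forall M, exists r : T * bool -> T -> Prop, F M ->
     (forall x, (M `*` [set: bool]) x -> exists2 y, M y & r x y) /\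
     (forall x x' y, (M `*` [set: bool]) x -> (M `*` [set: bool]) x' ->
        r x y -> r x' y -> x = x').
    move=> M; have [/FX[_ Mnat]|nFM] := pselect (F M); last by exists (fun _ _ => True).
    have /card_le_relP[r rP] : M `*` [set: bool] #<= M; last by exists r.
    rewrite (card_le_eqr Mnat); apply: countableX => //.
    by rewrite /countable (card_le_eql Mnat).
  apply/card_le_relP.
  exists (fun p y => exists M, [/\ F M, M p.1, M y & r M p y]); split.
    move=> [x b] [/= [M FM Mx] _]; have [y My rxy] := (rP M FM).1 (x, b) (conj Mx I).
    by exists y; exists M.
  move=> p q y _ _ [M [FM Mp My rp]] [N [FN Nq Ny rq]].
  have MN := Fdisj _ _ _ FM FN My Ny; subst N.
  exact: (rP M FM).2 rp rq.
have XU : X #<= U.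
  apply: card_le_trans UU.
  have /card_le_relP[r [rU rI]] : X `\` U #<= U.
    apply: (card_le_trans (finite_set_countable Ufin)).
    exact/infiniteP.
  apply/card_le_relP; exists (fun x p =>
    if p.2 then U x /\ p.1 = x else (X `\` U) x /\ r x p.1); split.
    move=> x Xx; have [Ux|nUx] := pselect (U x); first by exists (x, true).
    by have [//|y Uy rxy] := rU x; exists (y, false).
  by move=> x x' [y [|]] _ _ /= [Ux yx] [Ux' yx']; [rewrite -yx|apply: rI yx yx'].
have UX : U #<= X by apply: subset_card_le => x [M /FX[+ _]]; apply.
apply: card_le_trans UX; apply: card_le_trans UU.
move/card_le_relP: XU => [r [rU rI]]; apply/card_le_relP.
exists (fun p q => r p.1 q.1 /\ p.2 = q.2); split.
  by move=> [x b] [/= /rU[y Uy rxy] _]; exists (y, b).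
by move=> [x b] [x' b'] [y c] [/= Xx _] [/= Xx' _] [/= + ->] [+ ->] => /rI h /h ->.
Qed.

Lemma card_le_setU T U (A B : set T) (X : set U) :
  infinite_set X -> A #<= X -> B #<= X -> A `|` B #<= X.
Proof.
move=> /infinite_card_le_setX_bool; move/[swap]/card_le_relP => [r [rX rI]].
move/[swap]/card_le_relP => [s [sX sI]]; apply: card_le_trans.
apply/card_le_relP; exists (fun x p =>
  if p.2 then A x /\ r x p.1 else B x /\ s x p.1); split.
  move=> x [Ax|Bx].
    by have [y Xy rxy] := rX x Ax; exists (y, true).
  by have [y Xy rxy] := sX x Bx; exists (y, false).
move=> x x' [y [|]] _ _ /= [Ax xy] [Ax' x'y]; first exact: rI xy x'y.
exact: sI xy x'y.
Qed.

(** * Left ideals and complements of a maximal one *)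

Section LeftIdeals.
Variable R : pzRingType.
Implicit Types (I J K T : set R) (x y : R).

Lemma left_idealsP I :
  left_ideals R I <-> I 0 /\ forall a x y, I x -> I y -> I (a * x + y).
Proof.
split=> [[I0 IZ]|[I0 IZ]]; split.
- exact: set_mem.
- by move=> a x y Ix Iy; apply/set_mem/(IZ a); exact: mem_set.
- exact: mem_set.
- by move=> a x y /set_mem Ix /set_mem Iy; apply/mem_set/IZ.
Qed.

Lemma left_ideal0 I : left_ideals R I -> I 0.
Proof. by case/left_idealsP. Qed.

Lemma left_idealM I a x : left_ideals R I -> I x -> I (a * x).
Proof. by case/left_idealsP=> I0 IZ Ix; rewrite -[a * x]addr0; exact: IZ. Qed.

Lemma left_idealD I x y : left_ideals R I -> I x -> I y -> I (x + y).
Proof. by case/left_idealsP=> I0 IZ Ix Iy; rewrite -[x]mul1r; exact: IZ. Qed.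

Lemma left_idealB I x y : left_ideals R I -> I x -> I y -> I (x - y).
Proof.
move=> LI Ix Iy; apply: left_idealD => //; rewrite -mulN1r.
exact: left_idealM.
Qed.

Lemma left_ideal_set0 : left_ideals R [set 0].
Proof.
by apply/left_idealsP; split=> // a x y -> ->; rewrite mulr0 addr0.
Qed.

Lemma left_ideal_setT I : left_ideals R I -> I 1 -> I = setT.
Proof.
move=> LI I1; apply/seteqP; split=> // x _.
by rewrite -[x]mulr1; exact: left_idealM.
Qed.

Lemma left_ideal_neq0 I : left_ideals R I -> I <> [set 0] ->
  exists2 x, I x & x <> 0.
Proof.
move=> LI I0; apply: contrapT => nex; apply: I0; apply/seteqP; split=> x.
  by move=> Ix; apply: contrapT => x0; apply: nex; exists x.
by move=> ->; exact: left_ideal0.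
Qed.

Lemma left_ideal_cap I J : left_ideals R I -> left_ideals R J ->
  left_ideals R (I `&` J).
Proof.
move=> /left_idealsP[I0 IZ] /left_idealsP[J0 JZ]; apply/left_idealsP.
by split=> // a x y [? ?] [? ?]; split; [exact: IZ|exact: JZ].
Qed.

Lemma left_ideal_preim_mulr I c : left_ideals R I ->
  left_ideals R [set x | I (x * c)].
Proof.
move=> /left_idealsP[I0 IZ]; apply/left_idealsP; split=> /=.
  by rewrite mul0r.
by move=> a x y Ix Iy; rewrite mulrDl -mulrA; exact: IZ.
Qed.

Definition principal x : set R := [set y | exists r, y = r * x].

Lemma principal_left_ideal x : left_ideals R (principal x).
Proof.
apply/left_idealsP; split; first by exists 0; rewrite mul0r.
by move=> a _ _ [r ->] [s ->]; exists (a * r + s); rewrite mulrDl mulrA.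
Qed.

Lemma principal_id x : principal x x.
Proof. by exists 1; rewrite mul1r. Qed.

Lemma principal_sub I x : left_ideals R I -> I x -> principal x `<=` I.
Proof. by move=> LI Ix _ [r ->]; exact: left_idealM. Qed.

Lemma maximal_left_ideal_split T x : maximal_left_ideal T -> ~ T x ->
  exists2 t, T t & exists r, 1 = t + r * x.
Proof.
move=> [LT _ Tmax] nTx.
pose J := [set y | exists2 t, T t & exists r, y = t + r * x].
have LJ : left_ideals R J.
  apply/left_idealsP; split.
    by exists 0; [exact: left_ideal0|exists 0; rewrite mul0r addr0].
  move=> a _ _ [t Tt [r ->]] [s Ts [r' ->]].
  exists (a * t + s); first by case/left_idealsP: LT => _; exact.
  by exists (a * r + r'); rewrite mulrDr mulrDl mulrA addrACA.
have TJ : T `<=` J by move=> t Tt; exists t => //; exists 0; rewrite mul0r addr0.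
have [JT|JT] := Tmax _ LJ TJ; last by have : J 1 by rewrite JT.
case: nTx; rewrite -JT; exists 0; first exact: left_ideal0.
by exists 1; rewrite mul1r add0r.
Qed.

Lemma maximal_left_ideal_neq0 T : graph_vertices R !=set0 ->
  maximal_left_ideal T -> T <> [set 0].
Proof.
move=> [K [LK K0 KT]] [LT TT Tmax] T0.
have [||//] := Tmax _ LK; last by move=> KT0; apply: K0; rewrite KT0.
by rewrite T0 => _ ->; exact: left_ideal0.
Qed.

Lemma complement_idempotent T K : maximal_left_ideal T -> left_ideals R K ->
  K <> [set 0] -> T `&` K = [set 0] ->
  exists e, [/\ e * e = e, e <> 0, K e & T = [set x | x * e = 0]].
Proof.
move=> Tmax LK K0 TK; have [LT TT _] := Tmax.
have TKP x : T x -> K x -> x = 0.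
  by move=> Tx Kx; have : (T `&` K) x by []; rewrite TK.
have [x Kx x0] := left_ideal_neq0 LK K0.
have [|t Tt [r tr]] := maximal_left_ideal_split Tmax (x := x).
  by move=> Tx; apply: x0; exact: TKP.
set e := r * x in tr; have Ke : K e by exact: left_idealM.
have Te y : T y -> y * e = 0.
  move=> Ty; apply: TKP; last exact: left_idealM.
  have -> : e = 1 - t by rewrite tr addrAC subrr add0r.
  by rewrite mulrBr mulr1; apply: left_idealB => //; exact: left_idealM.
exists e; split => //.
- by rewrite -[RHS]mul1r [in RHS]tr mulrDl (Te t Tt) add0r.
- by move=> e0; apply: TT; apply: left_ideal_setT => //; rewrite tr e0 addr0.
apply/seteqP; split=> y; first exact: Te.
by move=> /= ye; rewrite -[y]mulr1 tr mulrDr ye addr0; exact: left_idealM.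
Qed.

End LeftIdeals.

Section Twist.
Variables (R : pzRingType) (e : R).
Implicit Types (L K : set R) (c x : R).
Hypothesis ee : e * e = e.
Hypothesis e0 : e <> 0.

Definition right_annihilated : set R := [set x | x * e = 0].
Local Notation T := right_annihilated.

Definition off_diagonal : set R := [set c | e * c = c /\ c * e = 0].
Local Notation V := off_diagonal.

(* L + R(e + c) when L is a left ideal inside T and c is in V. *)
Definition twist L c : set R := [set x | L (x - x * (e + c))].

Lemma right_annihilated_left_ideal : left_ideals R T.
Proof. exact: (left_ideal_preim_mulr e (left_ideal_set0 R)). Qed.

Lemma off_diagonalB c d : V c -> V d -> V (c - d).
Proof. by move=> [ec ce] [ed de]; split; rewrite ?mulrBr ?mulrBl ?ec ?ed ?ce ?de ?subrr. Qed.

Lemma off_diagonalD c d : V c -> V d -> V (c + d).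
Proof. by move=> [ec ce] [ed de]; split; rewrite ?mulrDr ?mulrDl ?ec ?ed ?ce ?de ?addr0. Qed.

Lemma off_diagonal_mul0 c d : V c -> V d -> c * d = 0.
Proof. by move=> [_ ce] [ed _]; rewrite -ed mulrA ce mul0r. Qed.

Lemma twist_left_ideal L c : left_ideals R L -> left_ideals R (twist L c).
Proof.
move=> LL; have := left_ideal_preim_mulr (1 - (e + c)) LL.
by congr left_ideals; apply/funext => x /=; rewrite mulrBr mulr1.
Qed.

Lemma twist_ann L c x : V c -> T x -> twist L c x = L x.
Proof.
move=> [ec _] xe; rewrite /twist /= mulrDr -ec [x * (e * c)]mulrA.
by rewrite (xe : x * e = 0) mul0r addr0 subr0.
Qed.

Lemma twist_mem L c : left_ideals R L -> V c -> twist L c (e + c).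
Proof.
move=> LL Vc; have cc := off_diagonal_mul0 Vc Vc; case: Vc => ec ce.
rewrite /twist /= mulrDl !mulrDr ee ec ce cc !addr0 subrr.
exact: left_ideal0.
Qed.

Lemma twist_nT L c : left_ideals R L -> V c -> twist L c <> T.
Proof.
move=> LL Vc eqT; have := twist_mem LL Vc; rewrite eqT /T /= mulrDl ee.
by case: Vc => _ ->; rewrite addr0.
Qed.

Lemma twist_inj L L' c c' : left_ideals R L -> left_ideals R L' ->
  L `<=` T -> L' `<=` T -> V c -> V c' ->
  twist L c = twist L' c' -> L = L' /\ L' (c - c').
Proof.
move=> LL LL' LT LT' Vc Vc' eqtw; split.
  apply/seteqP; split=> x Lx.
    by rewrite -(twist_ann _ Vc' (LT x Lx)) -eqtw (twist_ann _ Vc (LT x Lx)).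
  by rewrite -(twist_ann _ Vc (LT' x Lx)) eqtw (twist_ann _ Vc' (LT' x Lx)).
have cc' := off_diagonal_mul0 Vc Vc'.
have := twist_mem LL Vc; rewrite eqtw /twist /= mulrDl !mulrDr ee cc'.
case: Vc Vc' => _ -> [-> _].
by rewrite !addr0 opprD addrACA subrr add0r.
Qed.

Lemma neighbours_twist L c : left_ideals R L -> L `<=` T -> L <> [set 0] ->
  L <> T -> V c -> neighbours T (twist L c).
Proof.
move=> LL LT L0 LnT Vc; split; last first.
  split; first by move/esym; exact: twist_nT.
  move=> TL; apply: L0; rewrite -TL; apply/seteqP; split=> x.
    by move=> Lx; split; [exact: LT|rewrite twist_ann //; exact: LT].
  by move=> [Tx]; rewrite twist_ann.
split; first exact: twist_left_ideal.
  move=> tw0; have [x Lx x0] := left_ideal_neq0 LL L0; apply: x0.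
  by have : twist L c x; [rewrite twist_ann //; exact: LT|rewrite tw0].
move=> twT; apply: LnT; apply/seteqP; split=> // x Tx.
by rewrite -(twist_ann _ Vc Tx) twT.
Qed.

Hypothesis Tmax : maximal_left_ideal T.

Lemma maximal_ann_inv x : x * e <> 0 -> exists r, r * x * e = e.
Proof.
move=> xe; have [t Tt [r tr]] := maximal_left_ideal_split Tmax xe.
by exists r; rewrite -[RHS]mul1r tr mulrDl (Tt : t * e = 0) add0r.
Qed.

Lemma complement_twist K : left_ideals R K -> K <> [set 0] ->
  T `&` K = [set 0] -> exists2 c, V c & K = twist [set 0] c.
Proof.
move=> LK K0 TK; have [e' [ee' _ Ke' TE]] := complement_idempotent Tmax LK K0 TK.
have T1 : T (1 - e) by rewrite /T /= mulrBl mul1r ee subrr.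
have e'e : e * e' = e'.
  move: T1; rewrite TE /= mulrBl mul1r => /eqP.
  by rewrite subr_eq0 => /eqP.
have e'e2 : e' * e = e.
  have : T (1 - e') by rewrite TE /= mulrBl mul1r ee' subrr.
  by rewrite /T /= mulrBl mul1r => /eqP; rewrite subr_eq0 => /eqP.
exists (e' - e); first by split; rewrite ?mulrBr ?mulrBl ?e'e ?e'e2 ee ?subrr.
apply/seteqP; split=> x; rewrite /twist /= [e + _]addrC subrK.
  move=> Kx; have : (T `&` K) (x - x * e'); last by rewrite TK.
  split; last by apply: left_idealB => //; exact: left_idealM.
  by rewrite TE /= mulrBl -mulrA ee' subrr.
by move=> /eqP; rewrite subr_eq0 => /eqP ->; exact: left_idealM.
Qed.

Lemma graph_vertices_decomposition :
  graph_vertices R `<=` (neighbours T `|` [set T]) `|` (twist [set 0]) @` V.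
Proof.
move=> K GK; have [LK K0 KT] := GK.
have [->|TnK] := pselect (T = K); first by left; right.
have [TK|TK] := pselect (T `&` K = [set 0]).
  by right; have [c Vc ->] := complement_twist LK K0 TK; exists c.
by left; left.
Qed.

End Twist.

Lemma small_degree_off_diagonal (R : pzRingType) (T : set R) :
  infinite_set (graph_vertices R) -> maximal_left_ideal T -> small_degree T ->
  exists e, [/\ e * e = e, e <> 0, T = right_annihilated e,
    infinite_set (off_diagonal e) & card_lt (neighbours T) (off_diagonal e)].
Proof.
move=> Ginf Tmax [NG nGN].
have fin1 U (x : U) : finite_set [set x] by exact: finite_set1.
have [[K [LK K0 TK]]|nK] := pselect
    (exists K, [/\ left_ideals R K, K <> [set 0] & T `&` K = [set 0]]); last first.
  exfalso; apply: nGN.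
  have Gsub : graph_vertices R `<=` neighbours T `|` [set T].
    move=> K GK; have [LK K0 KT] := GK.
    have [->|TnK] := pselect (T = K); first by right.
    by left; split=> //; split=> // TK; apply: nK; exists K.
  have Ninf : infinite_set (neighbours T).
    by move=> finN; apply: Ginf; apply: sub_finite_set Gsub _; rewrite finite_setU.
  apply: card_le_trans (subset_card_le Gsub) _.
  apply: card_le_setU => //.
  apply: card_le_trans (finite_set_countable (fin1 _ T)) _.
  exact/infiniteP.
have [e [ee e0 Ke TE]] := complement_idempotent Tmax LK K0 TK.
rewrite -/(right_annihilated e) in TE; subst T.
have Gsub := graph_vertices_decomposition ee Tmax.
set N := neighbours _ in NG nGN Gsub; set V := off_diagonal e in Gsub.
have NinfGN : infinite_set N -> ~ (V #<= N).
  move=> Ninf VN; apply: nGN; apply: card_le_trans (subset_card_le Gsub) _.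
  apply: card_le_setU => //; last exact: card_le_trans (card_image_le _ _) VN.
  apply: card_le_setU => //.
  apply: card_le_trans (finite_set_countable (fin1 _ _)) _.
  exact/infiniteP.
have finGV : finite_set N -> ~ finite_set V.
  move=> finN finV; apply: Ginf; apply: (sub_finite_set Gsub).
  by rewrite !finite_setU; split; [split|exact: finite_image].
have nVN : ~ (V #<= N).
  have [finN VN|/NinfGN//] := pselect (finite_set N).
  exact: (finGV finN (card_le_finite VN finN)).
have NV : N #<= V by have [//|/nVN] := card_le_comparable N V.
exists e; split=> // finV; apply: finGV (finV).
exact: card_le_finite NV finV.
Qed.

(** * The off-diagonal Peirce component *)

Section Peirce.
Variables (R : pzRingType) (e : R).
Hypotheses (ee : e * e = e) (e0 : e <> 0).
Local Notation T := (right_annihilated e).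
Local Notation V := (off_diagonal e).
Hypothesis Tmax : maximal_left_ideal T.

Definition peirce_corner : set R := [set d | e * d = d /\ d * e = d].
Local Notation D := peirce_corner.

Lemma peirce_corner1 : D e.
Proof. by split. Qed.

Lemma peirce_cornerB x y : D x -> D y -> D (x - y).
Proof. by move=> [ex xe] [ey ye]; split; rewrite (mulrBr, mulrBl) ?ex ?ey ?xe ?ye. Qed.

Lemma peirce_cornerM x y : D x -> D y -> D (x * y).
Proof. by move=> [ex xe] [ey ye]; split; rewrite ?mulrA ?ex // -mulrA ye. Qed.

Lemma peirce_corner_mul x : D (e * x * e).
Proof. by split; rewrite ?mulrA ?ee // -!mulrA ee. Qed.

Lemma peirce_corner_off_diagonal d c : D d -> V c -> V (d * c).
Proof. by move=> [ed de] [ec ce]; split; [rewrite mulrA ed|rewrite -mulrA ce mulr0]. Qed.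

Lemma peirce_corner_inv d : D d -> d <> 0 -> exists2 d', D d' & d' * d = e.
Proof.
move=> [ed de] d0; have [|r re] := maximal_ann_inv Tmax (x := d); first by rewrite de.
exists (e * r * e); first exact: peirce_corner_mul.
by rewrite -!mulrA ed -{1}de (mulrA r) re ee.
Qed.

Lemma off_diagonal_principal c p : V c -> V p -> principal p c ->
  exists2 d, D d & c = d * p.
Proof.
move=> [ec _] [ep _] [r cr]; exists (e * r * e); first exact: peirce_corner_mul.
by rewrite -!mulrA ep -cr ec.
Qed.

Lemma corner_mul_eq0 d a : V a -> a <> 0 -> D d -> d * a = 0 -> d = 0.
Proof.
move=> [ea _] a0 Dd da; apply: contrapT => /(peirce_corner_inv Dd)[d' _ d'd].
by apply: a0; rewrite -ea -d'd -mulrA da mulr0.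
Qed.

(* With p = a + x b, a vector x a + y b + w of V (w in a transversal of V
   modulo the plane spanned by a and b) is recovered from the "affine line"
   y b + w + D p, that is, from the left ideal R p + R (e + y b + w). *)
Lemma off_diagonal_card_le_neighbours a b : V a -> V b ->
  (forall x y, D x -> D y -> x * a + y * b = 0 -> x = 0 /\ y = 0) ->
  V #<= neighbours T.
Proof.
move=> Va Vb indep.
have [ea _] := Va; have [eb _] := Vb.
have D0 : D 0 by split; rewrite ?mulr0 ?mul0r.
pose spn u := exists x y, [/\ D x, D y & u = x * a + y * b].
have spnB u v : spn u -> spn v -> spn (u - v).
  move=> [x [y [Dx Dy ->]]] [x' [y' [Dx' Dy' ->]]].
  exists (x - x'), (y - y'); split; try exact: peirce_cornerB.
  by rewrite !mulrBl opprD addrACA.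
have spn0 : spn 0 by exists 0, 0; rewrite !mul0r addr0.
pose rep v := xget 0 [set u | spn (v - u)].
have repP v : spn (v - rep v).
  by apply: (@xgetPex _ 0 [set u | spn (v - u)]); exists v; rewrite /= subrr.
have rep_eq v v' : spn (v - v') -> rep v = rep v'.
  move=> vv'; congr xget; apply/seteqP; split=> u /= vu.
    have -> : v' - u = (v - u) - (v - v').
      by rewrite opprB [RHS]addrC addrA subrK.
    exact: spnB.
  have -> : v - u = (v' - u) - (0 - (v - v')).
    by rewrite sub0r opprK [RHS]addrC addrA subrK.
  by apply: (spnB) => //; exact: (spnB _ _ spn0).
have Vp x : D x -> V (a + x * b).
  by move=> Dx; apply: off_diagonalD => //; exact: peirce_corner_off_diagonal.
apply/card_le_relP; exists (fun v K => exists x y, [/\ D x, D y,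
  v = x * a + (y * b + rep v) &
  K = twist e (principal (a + x * b)) (y * b + rep v)]); split.
  move=> v Vv; have [x [y [Dx Dy vE]]] := repP v.
  exists (twist e (principal (a + x * b)) (y * b + rep v)); last first.
    by exists x, y; split=> //; rewrite addrA -vE subrK.
  have Vxa := peirce_corner_off_diagonal Dx Va.
  apply: neighbours_twist => //.
  - exact: principal_left_ideal.
  - apply: principal_sub; first exact: right_annihilated_left_ideal.
    by have [] := Vp _ Dx.
  - move=> pr0; have := principal_id (a + x * b); rewrite pr0 => p0.
    have [|e00 _] := indep e x peirce_corner1 Dx; first by rewrite ea.
    exact: e0.
  - move=> prT; have : principal (a + x * b) b.
      by rewrite prT; have [] := Vb.
    move=> /(off_diagonal_principal Vb (Vp _ Dx))[d Dd bE].
    have [//|||d0 _] := indep d (d * x - e).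
    + by apply: peirce_cornerB => //; exact: peirce_cornerM.
    + by rewrite mulrBl addrA -mulrA -mulrDr -bE eb subrr.
    have [//|//||_ /e0//] := indep 0 e.
    by rewrite mul0r add0r eb bE d0 mul0r.
  - have -> : y * b + rep v = v - x * a.
      by rewrite -[v in RHS](subrK (rep v)) vE addrAC [_ + y * b]addrC addrK.
    exact: off_diagonalB.
move=> v v' K Vv Vv' [x [y [Dx Dy vE ->]]] [x' [y' [Dx' Dy' vE']]].
have VyR u z t : D z -> V u -> u = z * a + t -> V t.
  move=> Dz Vu uE; have -> : t = u - z * a by rewrite uE addrC addKr.
  by apply: off_diagonalB => //; exact: peirce_corner_off_diagonal.
have prsub z : D z -> principal (a + z * b) `<=` T.
  move=> Dz; apply: principal_sub; first exact: right_annihilated_left_ideal.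
  by have [] := Vp _ Dz.
move=> /(twist_inj ee (principal_left_ideal _) (principal_left_ideal _)
  (prsub _ Dx) (prsub _ Dx') (VyR _ _ _ Dx Vv vE) (VyR _ _ _ Dx' Vv' vE'))[prE].
have xx' : x = x'.
  have := principal_id (a + x * b); rewrite prE.
  move=> /(off_diagonal_principal (Vp _ Dx) (Vp _ Dx'))[d Dd pE].
  have [|||] := indep (e - d) (x - d * x').
  - by apply: peirce_cornerB.
  - by apply: peirce_cornerB => //; exact: peirce_cornerM.
  - rewrite !mulrBl addrACA -opprD -mulrA -mulrDr -pE ea subrr //.
  move=> /eqP; rewrite subr_eq0 => /eqP <- /eqP; rewrite subr_eq0 => /eqP ->.
  by have [] := Dx'.
subst x'.
have Vdiff : V (y * b + rep v - (y' * b + rep v')).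
  by apply: off_diagonalB; [exact: VyR vE|exact: VyR vE'].
move=> /(off_diagonal_principal Vdiff (Vp _ Dx))[d Dd dE].
have vv' : v - v' = d * (a + x * b).
  by rewrite vE vE' opprD addrACA subrr add0r.
have repE : rep v = rep v'.
  apply: rep_eq; rewrite vv'; exists d, (d * x); split=> //.
    exact: peirce_cornerM.
  by rewrite mulrDr mulrA.
have [//|||d0 _] := indep d (d * x - (y - y')).
- by apply: peirce_cornerB; [exact: peirce_cornerM|exact: peirce_cornerB].
- rewrite mulrBl addrA -mulrA -mulrDr -dE repE opprD addrACA subrr addr0.
  by rewrite mulrBl subrr.
by move: vv'; rewrite d0 mul0r => /eqP; rewrite subr_eq0 => /eqP.
Qed.

Hypothesis nVN : ~ (V #<= neighbours T).

Lemma off_diagonal_line a c : V a -> a <> 0 -> V c -> exists2 d, D d & c = d * a.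
Proof.
move=> Va a0 Vc; apply: contrapT => nd; apply: nVN.
apply: (off_diagonal_card_le_neighbours Va Vc) => x y Dx Dy xy0.
have [y0|/(peirce_corner_inv Dy)[y' Dy' y'y]] := pselect (y = 0).
  split=> //; apply: (corner_mul_eq0 Va a0 Dx).
  by move: xy0; rewrite y0 mul0r addr0.
exfalso; apply: nd; exists (0 - y' * x).
  by apply: peirce_cornerB; [split; rewrite ?mulr0 ?mul0r|exact: peirce_cornerM].
have [<- _] := Vc; rewrite -y'y sub0r mulNr -!mulrA; apply/eqP.
by rewrite -addr_eq0 -mulrDr addrC xy0 mulr0.
Qed.

Lemma sub_ann_mem_off_diagonal a L : V a -> a <> 0 ->
  left_ideals R L -> L `<=` T -> L <> [set 0] -> L a.
Proof.
move=> Va a0 LL LT L0; have [->|LnT] := pselect (L = T); first by have [] := Va.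
apply: contrapT => nLa; apply: nVN.
apply: (card_le_inj (f := twist e L)).
  by move=> c Vc; apply: neighbours_twist.
move=> c c' Vc Vc' /(twist_inj ee LL LL LT LT Vc Vc')[_ Lcc'].
apply: contrapT => ncc'; apply: nLa.
have [|d _ ->] := off_diagonal_line (off_diagonalB Vc Vc') _ Va.
  by move/eqP; rewrite subr_eq0 => /eqP.
exact: left_idealM.
Qed.

Lemma lower_corner0 a r : V a -> a <> 0 -> principal a <> T ->
  r * e = e * r * e.
Proof.
move=> Va a0 aT; apply: contrapT => nr; apply: aT.
pose z := r * e - e * r * e.
have ze : z * e = z by rewrite mulrBl -!mulrA ee !mulrA.
have ez : e * z = 0 by rewrite mulrBr !mulrA ee subrr.
have [|s sz] := maximal_ann_inv Tmax (x := z).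
  by rewrite ze; move/eqP; rewrite subr_eq0 => /eqP.
pose b := e * s - e * s * e.
have Vb : V b by split; rewrite (mulrBr, mulrBl) ?mulrA ?ee // -!mulrA ee subrr.
have bz : b * z = e.
  rewrite mulrBl -[e * s * e * z]mulrA ez mulr0 subr0 -ze -!mulrA (mulrA s) sz.
  exact: ee.
have [d _ bE] := off_diagonal_line Va a0 Vb.
have Tb : forall x, T x -> x = x * z * b.
  pose L := T `&` [set x | [set 0] (x * z)].
  have L0 : L = [set 0].
    apply: contrapT => /(sub_ann_mem_off_diagonal Va a0 _ _)[].
    - apply: left_ideal_cap; first exact: right_annihilated_left_ideal.
      exact: (left_ideal_preim_mulr z (left_ideal_set0 R)).
    - by move=> x [].
    by move=> _ /= az; apply: e0; rewrite -bz bE -mulrA az mulr0.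
  move=> x Tx; apply/eqP; rewrite -subr_eq0; apply/eqP.
  suff : L (x - x * z * b) by rewrite L0.
  split=> /=.
    have [_ be] := Vb; rewrite /right_annihilated /= mulrBl (Tx : x * e = 0).
    by rewrite -(mulrA (x * z)) be mulr0 subrr.
  by rewrite mulrBl -(mulrA (x * z)) bz -(mulrA x z e) ze subrr.
apply/seteqP; split.
  apply: principal_sub; first exact: right_annihilated_left_ideal.
  by have [] := Va.
by move=> x /Tb ->; rewrite bE mulrA; exists (x * z * d).
Qed.

Lemma faithful_corner a s : V a -> a <> 0 ->
  s * e = 0 -> e * s = 0 -> a * s = 0 -> s = 0.
Proof.
move=> Va a0 se es as0; apply: contrapT => s0.
have [|||r ar] := sub_ann_mem_off_diagonal Va a0 (L := principal s).
- exact: principal_left_ideal.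
- apply: principal_sub; first exact: right_annihilated_left_ideal.
  exact: se.
- by move=> pr0; apply: s0; have := principal_id s; rewrite pr0.
have Vb : V (e * r - e * r * e).
  by split; rewrite (mulrBr, mulrBl) ?mulrA ?ee // -!mulrA ee subrr.
have [d _ bE] := off_diagonal_line Va a0 Vb.
apply: a0; have [<- _] := Va; rewrite ar mulrA.
rewrite -[e * r](subrK (e * r * e)) bE mulrDl -!mulrA as0 es !mulr0.
by rewrite addr0.
Qed.

End Peirce.

(** * The corner ring and the two isomorphisms *)

Section CornerRing.
Variables (R : pzRingType) (e : R).

Definition corner_pred : {pred R} := [pred x | (e * x == x) && (x * e == x)].

Lemma corner_predP x : reflect (peirce_corner e x) (x \in corner_pred).
Proof. by rewrite inE; apply: (iffP andP) => -[/eqP ? /eqP ?]. Qed.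

Fact corner_zmod_closed : zmod_closed corner_pred.
Proof.
split; first by apply/corner_predP; split; rewrite ?mulr0 ?mul0r.
by move=> x y /corner_predP Dx /corner_predP Dy; apply/corner_predP/peirce_cornerB.
Qed.

HB.instance Definition _ :=
  GRing.isZmodClosed.Build R corner_pred corner_zmod_closed.

Definition corner (ee : e * e = e) (e0 : e <> 0) : Type :=
  {x : R | x \in corner_pred}.

Variables (ee : e * e = e) (e0 : e <> 0).

HB.instance Definition _ := [isSub of corner ee e0 for @sval R _].
HB.instance Definition _ := [Choice of corner ee e0 by <:].
HB.instance Definition _ := [SubChoice_isSubZmodule of corner ee e0 by <:].

Lemma corner_valP (x : corner ee e0) : peirce_corner e (val x).
Proof. exact/corner_predP/(valP x). Qed.

Definition corner_in x (Dx : peirce_corner e x) : corner ee e0 :=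
  Sub x (introT (corner_predP x) Dx).

Definition corner_one := corner_in (peirce_corner1 ee).
Definition corner_mul (x y : corner ee e0) :=
  corner_in (peirce_cornerM (corner_valP x) (corner_valP y)).

Fact corner_mulA : associative corner_mul.
Proof. by move=> x y z; apply/val_inj; rewrite /= mulrA. Qed.
Fact corner_mul1 : left_id corner_one corner_mul.
Proof. by move=> x; apply/val_inj; have [] := corner_valP x. Qed.
Fact corner_mulr1 : right_id corner_one corner_mul.
Proof. by move=> x; apply/val_inj; have [] := corner_valP x. Qed.
Fact corner_mulDl : left_distributive corner_mul +%R.
Proof. by move=> x y z; apply/val_inj; rewrite /= mulrDl. Qed.
Fact corner_mulDr : right_distributive corner_mul +%R.
Proof. by move=> x y z; apply/val_inj; rewrite /= mulrDr. Qed.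
Fact corner_one_neq0 : corner_one != 0.
Proof. by apply/eqP => /(congr1 val). Qed.

HB.instance Definition _ := GRing.Zmodule_isNzRing.Build (corner ee e0)
  corner_mulA corner_mul1 corner_mulr1 corner_mulDl corner_mulDr corner_one_neq0.

Lemma corner_valM (x y : corner ee e0) : val (x * y) = val x * val y.
Proof. by []. Qed.
Lemma corner_val0 : val (0 : corner ee e0) = 0.
Proof. by []. Qed.
Lemma corner_valB (x y : corner ee e0) : val (x - y) = val x - val y.
Proof. by []. Qed.
Lemma corner_valD (x y : corner ee e0) : val (x + y) = val x + val y.
Proof. by []. Qed.

Lemma corner_division : maximal_left_ideal (right_annihilated e) ->
  division_ring (corner ee e0).
Proof.
move=> Tmax x x0.
have inv (d : corner ee e0) : d != 0 -> exists d' : corner ee e0, d' * d = 1.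
  move=> d0; have [|d' Dd' d'd] := peirce_corner_inv ee Tmax (corner_valP d).
    by move=> vd0; case/eqP: d0; apply: val_inj.
  by exists (corner_in Dd'); apply: val_inj.
have [y yx] := inv x x0.
have y0 : y != 0 by apply: contra_eq_neq yx => ->; rewrite mul0r eq_sym oner_neq0.
have [z zy] := inv y y0; exists y; split=> //.
by rewrite -[x in LHS]mul1r -zy -(mulrA z) yx mulr1.
Qed.

Lemma corner_infinite a :
  infinite_set (off_diagonal e) ->
  (forall c, off_diagonal e c -> exists2 d, peirce_corner e d & c = d * a) ->
  infinite_set [set: corner ee e0].
Proof.
move=> Vinf Va finD; apply: Vinf.
apply: (sub_finite_set (B := range (fun d : corner ee e0 => val d * a))).
  by move=> c /Va[d Dd ->]; exists (corner_in Dd).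
exact: finite_image.
Qed.

End CornerRing.

Lemma ring_isomorphic_rel (R S : pzRingType) (Q : R -> S -> Prop) :
  (forall x, exists u, Q x u) -> (forall u, exists x, Q x u) ->
  (forall x u v, Q x u -> Q x v -> u = v) ->
  (forall x y u, Q x u -> Q y u -> x = y) ->
  Q 1 1 -> (forall x y u v, Q x u -> Q y v -> Q (x - y) (u - v)) ->
  (forall x y u v, Q x u -> Q y v -> Q (x * y) (u * v)) ->
  exists2 f : {rmorphism R -> S}, bijective f & forall x, Q x (f x).
Proof.
move=> /choice[f Qf] /choice[g Qg] Qfun Qinj Q1 QB QM.
pose fB := GRing.isZmodMorphism.Build R S f
  (fun x y => Qfun _ _ _ (Qf _) (QB _ _ _ _ (Qf x) (Qf y))).
pose fM := GRing.isMonoidMorphism.Build R S f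
  (conj (Qfun _ _ _ (Qf _) Q1)
   (fun x y => Qfun _ _ _ (Qf _) (QM _ _ _ _ (Qf x) (Qf y)))).
pose F : {rmorphism R -> S} := HB.pack f fB fM.
exists F => //; exists g => [x|u]; first exact: Qinj (Qg _) (Qf x).
exact: Qfun (Qf _) (Qg u).
Qed.

Lemma ord2P (P : 'I_2 -> Prop) : P 0 -> P 1 -> forall i, P i.
Proof.
move=> P0 P1 [[|[|//]] ilt].
  by rewrite (_ : Ordinal _ = 0) //; apply: val_inj.
by rewrite (_ : Ordinal _ = 1) //; apply: val_inj.
Qed.

Section Matrices2.
Variable D : nzRingType.
Implicit Types A B : 'M[D]_2.

Lemma mulmx2E A B i j : (A * B) i j = A i 0 * B 0 j + A i 1 * B 1 j.
Proof.
rewrite !mxE !big_ord_recl !big_ord0 /= !addr0.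
by have -> : lift ord0 ord0 = 1 :> 'I_2 by apply: val_inj.
Qed.

Lemma matrix2P A B : A 0 0 = B 0 0 -> A 0 1 = B 0 1 -> A 1 0 = B 1 0 ->
  A 1 1 = B 1 1 -> A = B.
Proof.
move=> ? ? ? ?; apply/matrixP.
by apply: ord2P; apply: ord2P.
Qed.

Definition mx2 (p q r s : D) : 'M[D]_2 :=
  \matrix_(i, j) if i == 0 then (if j == 0 then p else q)
                 else (if j == 0 then r else s).

Lemma mx2E p q r s :
  ((mx2 p q r s 0 0 = p) * (mx2 p q r s 0 1 = q) *
   (mx2 p q r s 1 0 = r) * (mx2 p q r s 1 1 = s))%type.
Proof. by rewrite !mxE. Qed.

End Matrices2.

(* (e, a) and (e, x) are the first row and the first column of a system of 2 x 2
   matrix units, whose last unit is x a. *)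
Lemma matrix_units_isomorphic (R : pzRingType) (e a x : R)
    (ee : e * e = e) (e0 : e <> 0) :
  e * a = a -> a * e = 0 -> e * x = 0 -> x * e = x -> a * x = e ->
  x * a = 1 - e -> ring_isomorphic R 'M[corner ee e0]_2.
Proof.
move=> ea ae ex xe ax xa.
have split1 r s t u : r * s * t * u = r * s * e * (e * t * u) + r * s * x * (a * t * u).
  rewrite !mulrA -(mulrA _ e e) ee -(mulrA _ x a) xa mulrBr mulr1 mulrBl mulrBl.
  by rewrite addrC subrK.
pose Q r (m : 'M[corner ee e0]_2) :=
  [/\ val (m 0 0) = e * r * e, val (m 0 1) = e * r * x,
      val (m 1 0) = a * r * e & val (m 1 1) = a * r * x].
have [||||||| f fbij _] := @ring_isomorphic_rel R _ Q; last by exists f.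
- move=> r.
  have D00 : peirce_corner e (e * r * e) by split; rewrite ?mulrA ?ee // -!mulrA ?ee.
  have D01 : peirce_corner e (e * r * x) by split; rewrite ?mulrA ?ee // -!mulrA ?xe.
  have D10 : peirce_corner e (a * r * e) by split; rewrite ?mulrA ?ea // -!mulrA ?ee.
  have D11 : peirce_corner e (a * r * x) by split; rewrite ?mulrA ?ea // -!mulrA ?xe.
  exists (mx2 (corner_in ee e0 D00) (corner_in ee e0 D01)
              (corner_in ee e0 D10) (corner_in ee e0 D11)).
  by rewrite /Q !mx2E.
- move=> m; exists (val (m 0 0) + val (m 0 1) * a + x * val (m 1 0) + x * val (m 1 1) * a).
  have [e00 e00'] := corner_valP (m 0 0); have [e01 e01'] := corner_valP (m 0 1).
  have [e10 e10'] := corner_valP (m 1 0); have [e11 e11'] := corner_valP (m 1 1).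
  have a0 i j : a * val (m i j) = 0.
    by have [<- _] := corner_valP (m i j); rewrite mulrA ae mul0r.
  have x0 i j : val (m i j) * x = 0.
    by have [_ <-] := corner_valP (m i j); rewrite -mulrA ex mulr0.
  split; rewrite !mulrDr !mulrDl !mulrA.
  + by rewrite ex !mul0r e00 e00' -!mulrA ae !mulr0 !addr0.
  + by rewrite ex !mul0r e00 x0 e01 -!mulrA ax e01' !addr0 add0r.
  + by rewrite !a0 !mul0r ax e10 e10' -!mulrA ae !mulr0 addr0 !add0r.
  + by rewrite !a0 !mul0r ax e10 x0 e11 -!mulrA ax e11' !add0r.
- move=> r m n [m0 m1 m2 m3] [n0 n1 n2 n3].
  by apply: matrix2P; apply: val_inj; rewrite ?m0 ?m1 ?m2 ?m3.
- move=> r s m [m0 m1 m2 m3] [n0 n1 n2 n3].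
  have decomp t : t = e * t * e + e * t * x * a + x * (a * t * e) + x * (a * t * x) * a.
    have -> : x * (a * t * x) * a = (1 - e) * t * (1 - e) by rewrite -xa !mulrA.
    have -> : x * (a * t * e) = (1 - e) * t * e by rewrite -xa !mulrA.
    rewrite -(mulrA _ x) xa -!mulrDr [e + _]addrC subrK mulr1 -addrA -mulrDr.
    by rewrite [e + _]addrC subrK mulr1 -mulrDl [e + _]addrC subrK mul1r.
  by rewrite (decomp r) (decomp s) -m0 -m1 -m2 -m3 n0 n1 n2 n3.
- by split; rewrite !mxE /= mulr1 ?ee ?ex ?ae ?ax.
- move=> r s m n [m0 m1 m2 m3] [n0 n1 n2 n3].
  by split; rewrite !mxE corner_valB ?m0 ?m1 ?m2 ?m3 ?n0 ?n1 ?n2 ?n3 !(mulrBr, mulrBl).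
- move=> r s m n [m0 m1 m2 m3] [n0 n1 n2 n3].
  by split; rewrite mulmx2E corner_valD !corner_valM ?m0 ?m1 ?m2 ?m3 ?n0 ?n1 ?n2 ?n3
    -split1 ?mulrA.
Qed.

Section LineAction.
Variables (R : pzRingType) (e a : R) (ee : e * e = e) (e0 : e <> 0).
Local Notation D := (corner ee e0).

(* The paper's P: the elements of D by which right multiplications by elements
   of R act on the left line D a. *)
Definition line_action (Va : off_diagonal e a) : {pred D} :=
  [pred d : D | `[< exists r, a * r = val d * a >]].

Hypothesis Va : off_diagonal e a.

Fact line_action_subring_closed : subring_closed (line_action Va).
Proof.
have [ea ae] := Va; split.
- by apply/asboolP; exists 1; rewrite mulr1.
- move=> x y /asboolP[r rx] /asboolP[s sy]; apply/asboolP; exists (r - s).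
  by rewrite mulrBr rx sy corner_valB mulrBl.
- move=> x y /asboolP[r rx] /asboolP[s sy]; apply/asboolP; exists (r * s).
  by rewrite mulrA rx -mulrA sy corner_valM mulrA.
Qed.

HB.instance Definition _ :=
  GRing.isSubringClosed.Build D (line_action Va) line_action_subring_closed.

Local Notation P := (line_action Va : subringClosed D).

Hypothesis a_free : forall d, peirce_corner e d -> d * a = 0 -> d = 0.
Hypothesis a_span : forall c, off_diagonal e c ->
  exists2 d, peirce_corner e d & c = d * a.
Hypothesis lower0 : forall r, r * e = e * r * e.
Hypothesis faithful : forall s, s * e = 0 -> e * s = 0 -> a * s = 0 -> s = 0.

Lemma triangular_isomorphic :
  exists2 f : {rmorphism R -> triangular_ring P}, bijective f &
    right_annihilated e = f @^-1` triangular_ideal P.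
Proof.
have [ea ae] := Va.
have aI (d d' : D) : val d * a = val d' * a -> d = d'.
  move=> dd'; apply/eqP; rewrite -subr_eq0; apply/eqP/val_inj.
  by apply: a_free; [exact: corner_valP|rewrite corner_valB mulrBl dd' subrr].
pose M (u : triangular_ring P) : 'M[D]_2 := val u.
have M10 u : M u 1 0 = 0 by have /andP[/eqP] := valP u.
have M11 u : exists r, a * r = val (M u 1 1) * a.
  by have /andP[_ /asboolP] := valP u.
have MP (m : 'M[D]_2) : m 1 0 = 0 -> (exists r, a * r = val (m 1 1) * a) ->
    exists u, M u = m.
  move=> m10 m11; have tm : m \in triangular P.
    by apply/andP; split; [apply/eqP|apply/asboolP].
  by exists (Sub m tm); rewrite /M SubK.
pose Q r (u : triangular_ring P) :=
  [/\ val (M u 0 0) = e * r * e, val (M u 0 1) * a = e * r - e * r * e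
    & val (M u 1 1) * a = a * r].
have are r : a * r * e = 0 by rewrite -mulrA lower0 !mulrA ae !mul0r.
have [||||||| f fbij Qf] := @ring_isomorphic_rel R _ Q.
- move=> r.
  have D00 := peirce_corner_mul ee r.
  have [|d Dd dE] := a_span (c := e * r - e * r * e).
    by split; rewrite ?mulrBr ?mulrBl ?mulrA ?ee // -!mulrA ee subrr.
  have [|d' Dd' dE'] := a_span (c := a * r).
    by split; rewrite ?are // mulrA ea.
  have [||u Mu] := MP (mx2 (corner_in ee e0 D00) (corner_in ee e0 Dd)
              0 (corner_in ee e0 Dd')); rewrite ?mx2E //.
    by exists r.
  by exists u; rewrite /Q Mu !mx2E.
- move=> u; have [r ar] := M11 u.
  have [e00 e00'] := corner_valP (M u 0 0); have [e01 e01'] := corner_valP (M u 0 1).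
  have [e11 e11'] := corner_valP (M u 1 1).
  have ad (d : D) : a * val d = 0.
    by have [<- _] := corner_valP d; rewrite mulrA ae mul0r.
  exists (val (M u 0 0) + val (M u 0 1) * a + (r - e * r)).
  have er : e * (val (M u 0 0) + val (M u 0 1) * a + (r - e * r)) =
      val (M u 0 0) + val (M u 0 1) * a.
    by rewrite !mulrDr mulrN !mulrA ee subrr addr0 e00 e01.
  split; rewrite ?er.
  + by rewrite mulrDl e00' -mulrA ae mulr0 addr0.
  + by rewrite mulrDl e00' -mulrA ae mulr0 addr0 addrC addKr.
  + by rewrite !mulrDr mulrN !mulrA !ad ae !mul0r !add0r subr0 ar.
- move=> r u v [u0 u1 u2] [v0 v1 v2]; apply: val_inj.
  apply: matrix2P; first by apply: val_inj; rewrite u0.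
  + by apply: aI; rewrite u1.
  + by rewrite [LHS]M10 [RHS]M10.
  + by apply: aI; rewrite u2.
- move=> r s u [u0 u1 u2] [v0 v1 v2].
  have ers : e * r = e * s.
    by rewrite -[LHS](subrK (e * r * e)) -u1 v1 -u0 v0 subrK.
  apply/eqP; rewrite -subr_eq0; apply/eqP/faithful.
  + by rewrite mulrBl lower0 [s * e]lower0 ers subrr.
  + by rewrite mulrBr ers subrr.
  + by rewrite mulrBr -u2 v2 subrr.
- by split; rewrite /M /= !mxE /= ?mulr1 ?ee ?subrr ?mul0r.
- move=> r s u v [u0 u1 u2] [v0 v1 v2].
  have ME i j : M (u - v) i j = M u i j - M v i j by rewrite /M /= !mxE.
  split; rewrite ME corner_valB.
  + by rewrite u0 v0 mulrBr mulrBl.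
  + by rewrite mulrBl u1 v1 !(mulrBr, mulrBl) !opprD !opprK addrACA.
  + by rewrite mulrBl u2 v2 mulrBr.
- move=> r s u v [u0 u1 u2] [v0 v1 v2].
  have ME i j : M (u * v) i j = M u i 0 * M v 0 j + M u i 1 * M v 1 j.
    exact: mulmx2E.
  split; rewrite ME corner_valD !corner_valM.
  + rewrite M10 corner_val0 mulr0 addr0 u0 v0 !mulrA -(mulrA _ e e) ee.
    by rewrite -!mulrA (mulrA e s) -lower0.
  + rewrite mulrDl -!mulrA v1 v2 (mulrA _ a s) u1 u0 !mulrA.
    rewrite mulrBr mulrBl !mulrA -(mulrA _ e e) ee addrC addrA subrK.
    by rewrite -(mulrA (e * r) s e) [s * e]lower0 !mulrA.
  + by rewrite M10 mul0r add0r -mulrA v2 mulrA u2 mulrA.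
exists f => //; apply/seteqP; split=> r.
  rewrite /right_annihilated /triangular_ideal /= => re.
  by apply: val_inj; have [-> _ _] := Qf r; rewrite -mulrA re mulr0.
rewrite /right_annihilated /triangular_ideal /= => fr.
by rewrite lower0; have [<- _ _] := Qf r; rewrite /M fr.
Qed.

End LineAction.

(** * Transport along an isomorphism and 2 x 2 matrices *)

Section Transport.
Variables (R S : pzRingType) (f : {rmorphism R -> S}).
Hypothesis fbij : bijective f.
Implicit Types (I : set R) (J K T : set S).

Let finj : injective f. Proof. exact: bij_inj. Qed.

Lemma preim_bij_inj : injective (fun J => f @^-1` J).
Proof.
have [g fK gK] := fbij => J K JK; apply/seteqP; split=> x; rewrite -[x]gK.
  by rewrite -[J _]/((f @^-1` J) (g x)) JK.
by rewrite -[K _]/((f @^-1` K) (g x)) -JK.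
Qed.

Lemma preim_bij_surj I : exists J, I = f @^-1` J.
Proof.
exists (f @` I); apply/seteqP; split=> x; first by exists x.
by move=> [y Iy /finj <-].
Qed.

Lemma preim_set0 : f @^-1` [set 0] = [set 0].
Proof.
apply/seteqP; split=> x /=; last by move=> ->; rewrite rmorph0.
by rewrite -(rmorph0 f) => /finj.
Qed.

Lemma preim_left_ideals J : left_ideals R (f @^-1` J) <-> left_ideals S J.
Proof.
have [g fK gK] := fbij.
split=> /left_idealsP[J0 JZ]; apply/left_idealsP; split.
- by move: J0; rewrite /= rmorph0.
- move=> a x y Jx Jy; have := JZ (g a) (g x) (g y).
  by rewrite /= rmorphD rmorphM !gK; exact.
- by rewrite /= rmorph0.
- by move=> a x y Jx Jy; rewrite /= rmorphD rmorphM; exact: JZ.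
Qed.

Lemma preim_eq J K : f @^-1` J = f @^-1` K <-> J = K.
Proof. by split=> [/preim_bij_inj|->]. Qed.

Lemma preim_graph_vertices J :
  graph_vertices R (f @^-1` J) <-> graph_vertices S J.
Proof.
rewrite /graph_vertices /= -preim_set0 -(preimage_setT f).
split=> -[/preim_left_ideals LJ J0 JT]; split=> //.
- by move=> E; apply: J0; rewrite E.
- by move=> E; apply: JT; rewrite E.
- by move=> /preim_eq.
- by move=> /preim_eq.
Qed.

Lemma preim_maximal T : maximal_left_ideal (f @^-1` T) <-> maximal_left_ideal T.
Proof.
have [g fK gK] := fbij.
rewrite /maximal_left_ideal -(preimage_setT f).
split=> -[/preim_left_ideals LT TT Tmax]; split=> //.
- by move=> E; apply: TT; rewrite E.
- move=> J /preim_left_ideals LJ TJ.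
  have [|/preim_bij_inj ->|/preim_bij_inj ->] := Tmax _ LJ; last by right.
    by move=> x /TJ.
  by left.
- by move=> /preim_eq.
- move=> I; have [J ->] := preim_bij_surj I => /preim_left_ideals LJ TJ.
  have [|->|->] := Tmax _ LJ; last by right.
    by move=> x Tx; rewrite -[x]gK; apply: (TJ (g x)); rewrite /= gK.
  by left.
Qed.

Lemma preim_neighbours T K :
  neighbours (f @^-1` T) (f @^-1` K) <-> neighbours T K.
Proof.
rewrite /neighbours /graph_adj /= -preimage_setI -preim_set0.
split=> -[/preim_graph_vertices GK [TK TK0]]; split=> //.
  by split=> E; [apply: TK|apply: TK0]; rewrite E.
by split=> /preim_eq.
Qed.

Lemma card_neighbours_preim T : neighbours (f @^-1` T) #= neighbours T.
Proof.
have <- : (fun J => f @^-1` J) @` neighbours T = neighbours (f @^-1` T).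
  apply/seteqP; split=> I; first by move=> [K NK <-]; exact/preim_neighbours.
  have [J ->] := preim_bij_surj I => /preim_neighbours NJ.
  by exists J.
by apply: inj_card_eq => J K _ _; exact: preim_bij_inj.
Qed.

Lemma card_graph_vertices_preim : graph_vertices R #= graph_vertices S.
Proof.
have <- : (fun J => f @^-1` J) @` graph_vertices S = graph_vertices R.
  apply/seteqP; split=> I; first by move=> [K NK <-]; exact/preim_graph_vertices.
  have [J ->] := preim_bij_surj I => /preim_graph_vertices NJ.
  by exists J.
by apply: inj_card_eq => J K _ _; exact: preim_bij_inj.
Qed.

Lemma preim_small_degree T : small_degree (f @^-1` T) <-> small_degree T.
Proof.
rewrite /small_degree /card_lt.
rewrite (card_le_eql (card_neighbours_preim T)) (card_le_eqr card_graph_vertices_preim).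
by rewrite (card_le_eqr (card_neighbours_preim T)) (card_le_eql card_graph_vertices_preim).
Qed.

Lemma infinite_graph_vertices_preim :
  infinite_set (graph_vertices R) <-> infinite_set (graph_vertices S).
Proof. by rewrite (eq_finite_set card_graph_vertices_preim). Qed.

End Transport.

Lemma small_degree_set0 (R : pzRingType) (T : set R) :
  graph_vertices R !=set0 -> neighbours T = set0 -> small_degree T.
Proof.
move=> [K GK] N0; rewrite /small_degree N0; split; first exact: card_ge0.
by rewrite card_le0 => /eqP G0; rewrite G0 in GK.
Qed.

Lemma graph_vertices_maximal (R : pzRingType) (T : set R) :
  (forall K, graph_vertices R K -> T `&` K <> [set 0] -> T = K) ->
  graph_vertices R T -> maximal_left_ideal T.
Proof.
move=> TK [LT T0 TT]; split=> // J LJ TJ.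
have [->|JT] := pselect (J = setT); first by right.
have TJT : T `&` J = T by exact: setIidl.
left; symmetry; apply: TK; last by rewrite TJT.
split=> // J0; apply: T0; rewrite -TJT J0; apply/seteqP; split=> [x []//|x ->].
by split=> //; exact: left_ideal0.
Qed.

Section MatrixRing.
Variable D : nzRingType.
Hypothesis Ddiv : division_ring D.
Implicit Types (K L : set 'M[D]_2).

Lemma mx2M p q r s p' q' r' s' : mx2 p q r s * mx2 p' q' r' s' =
  mx2 (p * p' + q * r') (p * q' + q * s') (r * p' + s * r') (r * q' + s * s')
  :> 'M[D]_2.
Proof. by apply: matrix2P; rewrite mulmx2E !mx2E. Qed.

Lemma mx2D p q r s p' q' r' s' : mx2 p q r s + mx2 p' q' r' s' =
  mx2 (p + p') (q + q') (r + r') (s + s') :> 'M[D]_2.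
Proof. by apply: matrix2P; rewrite mxE !mx2E. Qed.

Lemma mx2B p q r s p' q' r' s' : mx2 p q r s - mx2 p' q' r' s' =
  mx2 (p - p') (q - q') (r - r') (s - s') :> 'M[D]_2.
Proof. by apply: matrix2P; rewrite !mxE /=. Qed.

Lemma mx2_eta (A : 'M[D]_2) : A = mx2 (A 0 0) (A 0 1) (A 1 0) (A 1 1).
Proof. by apply: matrix2P; rewrite mx2E. Qed.

Definition row_of K p q := K (mx2 p q 0 0).

Lemma row_of_mem K p q r s : left_ideals _ K ->
  K (mx2 p q r s) <-> row_of K p q /\ row_of K r s.
Proof.
move=> LK; split=> [Kpq|[Kpq Krs]].
  split; rewrite /row_of.
    have -> : mx2 p q 0 0 = mx2 1 0 0 0 * mx2 p q r s.
      by rewrite mx2M !mul1r !mul0r !addr0.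
    exact: left_idealM.
  have -> : mx2 r s 0 0 = mx2 0 1 0 0 * mx2 p q r s.
    by rewrite mx2M !mul1r !mul0r !add0r.
  exact: left_idealM.
have -> : mx2 p q r s = mx2 p q 0 0 + mx2 0 0 1 0 * mx2 r s 0 0.
  by rewrite mx2M !mul1r !mul0r !addr0 mx2D !addr0 !add0r.
by apply: left_idealD => //; exact: left_idealM.
Qed.

Lemma row_ofZ K t p q : left_ideals _ K -> row_of K p q -> row_of K (t * p) (t * q).
Proof.
move=> LK Kpq; rewrite /row_of.
have -> : mx2 (t * p) (t * q) 0 0 = mx2 t 0 0 0 * mx2 p q 0 0.
  by rewrite mx2M !mul0r !addr0.
exact: left_idealM.
Qed.

Lemma row_ofB K p q r s : left_ideals _ K -> row_of K p q -> row_of K r s ->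
  row_of K (p - r) (q - s).
Proof.
move=> LK Kpq Krs; rewrite /row_of.
have -> : mx2 (p - r) (q - s) 0 0 = mx2 p q 0 0 - mx2 r s 0 0.
  by rewrite mx2B !subrr.
exact: left_idealB.
Qed.

Lemma row_of_setT K : left_ideals _ K -> row_of K 1 0 -> row_of K 0 1 -> K = setT.
Proof.
move=> LK K10 K01; apply: left_ideal_setT => //.
have -> : 1 = mx2 1 0 0 1 :> 'M[D]_2.
  by apply: matrix2P; rewrite mx2E !mxE.
exact/row_of_mem.
Qed.

Lemma row_of_line K p q r s : left_ideals _ K -> K <> setT ->
  p != 0 \/ q != 0 -> row_of K p q -> row_of K r s ->
  exists t, r = t * p /\ s = t * q.
Proof.
move=> LK KT pq0 Kpq Krs.
have [p0|p0] := eqVneq p 0.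
  have q0 : q != 0 by case: pq0 => //; rewrite p0 eqxx.
  have [q' [q'q qq']] := Ddiv q0.
  exists (s * q'); rewrite p0 mulr0 -mulrA q'q mulr1; split=> //.
  apply/eqP; apply: contraT => r0; exfalso; apply: KT.
  have K01 : row_of K 0 1.
    by rewrite -q'q -[X in row_of _ X _](mulr0 q') -{1}p0; exact: row_ofZ.
  have [r' [r'r _]] := Ddiv r0.
  apply: row_of_setT => //.
  have := row_ofZ r' LK (row_ofB LK Krs (row_ofZ s LK K01)).
  by rewrite !mulr0 !mulr1 subr0 subrr mulr0 r'r.
have [p' [p'p pp']] := Ddiv p0.
exists (r * p'); rewrite -mulrA p'p mulr1; split=> //.
apply/eqP; rewrite -subr_eq0; apply: contraT => u0; exfalso; apply: KT.
have [u' [u'u _]] := Ddiv u0.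
have K01 : row_of K 0 1.
  have := row_ofZ u' LK (row_ofB LK Krs (row_ofZ (r * p') LK Kpq)).
  by rewrite -[r * p' * p]mulrA p'p mulr1 subrr mulr0 u'u.
apply: row_of_setT => //.
have := row_ofZ p' LK (row_ofB LK Kpq (row_ofZ q LK K01)).
by rewrite !mulr0 !mulr1 subr0 subrr mulr0 p'p.
Qed.

Lemma matrix_graph_no_edge K L :
  graph_vertices 'M[D]_2 K -> graph_vertices 'M[D]_2 L ->
  K `&` L <> [set 0] -> K = L.
Proof.
move=> GK GL KL0; have [[LK _ _] [LL _ _]] := (GK, GL).
have [A [KA LA] A0] := left_ideal_neq0 (left_ideal_cap LK LL) KL0.
wlog suff sub : K L GK GL KA LA {LK LL KL0} / K `<=` L.
  by apply/seteqP; split; exact: sub.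
have [LK _ KT] := GK; have [LL _ _] := GL.
have [p [q [pq0 Kpq Lpq]]] : exists p q,
    [/\ p != 0 \/ q != 0, row_of K p q & row_of L p q].
  move: KA LA A0; rewrite [A]mx2_eta => /(row_of_mem _ _ _ _ LK)[K1 K2].
  move=> /(row_of_mem _ _ _ _ LL)[L1 L2] A0.
  have [A00|A00] := eqVneq (A 0 0) 0; last by exists (A 0 0), (A 0 1); split=> //; left.
  have [A01|A01] := eqVneq (A 0 1) 0; last by exists (A 0 0), (A 0 1); split=> //; right.
  exists (A 1 0), (A 1 1); split=> //.
  have [A10|A10] := eqVneq (A 1 0) 0; last by left.
  right; apply/eqP => A11; apply: A0.
  by apply: matrix2P; rewrite !mx2E !mxE.
move=> B; rewrite [B]mx2_eta => /(row_of_mem _ _ _ _ LK)[K1 K2].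
apply/row_of_mem => //.
have [t [-> ->]] := row_of_line LK KT pq0 Kpq K1.
have [t' [-> ->]] := row_of_line LK KT pq0 Kpq K2.
by split; exact: row_ofZ.
Qed.

Lemma matrix_graph_infinite : infinite_set [set: D] ->
  infinite_set (graph_vertices 'M[D]_2).
Proof.
move=> Dinf Gfin; apply: Dinf; apply: card_le_finite Gfin.
pose K d : set 'M[D]_2 := [set A | A 0 1 = A 0 0 * d /\ A 1 1 = A 1 0 * d].
have Kd d : K d (mx2 1 d 0 0) by rewrite /K /= !mx2E mul1r mul0r.
apply: (card_le_inj (f := K)) => [d _|d d' _ _ KE]; last first.
  by have := Kd d; rewrite KE /K /= !mx2E mul1r => -[].
split.
- apply/left_idealsP; split; first by rewrite /K /= !mxE !mul0r.
  move=> A B C [B1 B2] [C1 C2]; rewrite /K /= mxE mulmx2E B1 B2 C1.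
  rewrite [X in _ = X * d]mxE mulmx2E !mulrDl !mulrA; split=> //.
  by rewrite mxE mulmx2E B1 B2 C2 [X in _ = X * d]mxE mulmx2E !mulrDl !mulrA.
- move=> K0; have := Kd d; rewrite K0 /= => /matrixP/(_ 0 0).
  by rewrite mx2E mxE; apply/eqP; exact: oner_neq0.
- move=> KT; have : K d (mx2 0 1 0 0) by rewrite KT.
  by rewrite /K /= !mx2E mul0r => -[/eqP]; rewrite (negbTE (oner_neq0 _)).
Qed.

End MatrixRing.

(** * The triangular ring *)

Lemma twist0_graph_vertices (R : pzRingType) (e c : R) :
  e * e = e -> e <> 0 -> right_annihilated e <> [set 0] -> off_diagonal e c ->
  graph_vertices R (twist e [set 0] c).
Proof.
move=> ee e0 T0 Vc; have L0 := left_ideal_set0 R; split.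
- exact: twist_left_ideal.
- move=> tw0; have := twist_mem ee L0 Vc; rewrite tw0 /= => ec; apply: e0.
  have [_ ce] := Vc; have : (e + c) * e = 0 by rewrite ec mul0r.
  by rewrite mulrDl ee ce addr0.
move=> twT; apply: T0; apply/seteqP; split=> x; last first.
  by move=> ->; apply: left_ideal0; exact: right_annihilated_left_ideal.
by move=> Tx; rewrite -(twist_ann _ Vc Tx) twT.
Qed.

Section TriangularRing.
Variables (D : nzRingType) (P : subringClosed D).
Hypothesis Ddiv : division_ring D.
Local Notation S := (triangular_ring P).
Local Notation T := (triangular_ideal P).
Implicit Types (K L : set S) (u v : S) (p q : subring P).

Fact tri_subproof (x y : D) (p : subring P) : mx2 x y 0 (val p) \in triangular P.
Proof. by rewrite inE !mx2E eqxx; exact: valP. Qed.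

Definition tri x y p : S := Sub (mx2 x y 0 (val p)) (tri_subproof x y p).

Lemma tri_val x y p : val (tri x y p) = mx2 x y 0 (val p).
Proof. exact: SubK. Qed.

Lemma tri_eta u : exists x y p, u = tri x y p.
Proof.
have /andP[/eqP u10 u11] := valP u.
exists (val u 0 0), (val u 0 1), (Sub (val u 1 1) u11); apply: val_inj.
by rewrite tri_val; apply: matrix2P; rewrite !mx2E ?u10 ?SubK.
Qed.

Lemma triM x y p x' y' p' :
  tri x y p * tri x' y' p' = tri (x * x') (x * y' + y * val p') (p * p').
Proof.
apply: val_inj; rewrite rmorphM !tri_val rmorphM mx2M.
by rewrite !(mul0r, mulr0) !addr0 add0r.
Qed.

Lemma triD x y p x' y' p' :
  tri x y p + tri x' y' p' = tri (x + x') (y + y') (p + p').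
Proof. by apply: val_inj; rewrite rmorphD !tri_val rmorphD mx2D addr0. Qed.

Lemma triB x y p x' y' p' :
  tri x y p - tri x' y' p' = tri (x - x') (y - y') (p - p').
Proof. by apply: val_inj; rewrite rmorphB !tri_val rmorphB mx2B subr0. Qed.

Lemma tri_inj x y p x' y' p' :
  tri x y p = tri x' y' p' -> [/\ x = x', y = y' & p = p'].
Proof.
move=> /(congr1 val); rewrite !tri_val => /matrixP E.
split; first by have := E 0 0; rewrite !mx2E.
  by have := E 0 1; rewrite !mx2E.
by apply: val_inj; have := E 1 1; rewrite !mx2E.
Qed.

Lemma subring_val_eq0 p : val p = 0 -> p = 0.
Proof. by move=> p0; apply: val_inj; rewrite p0 rmorph0. Qed.

Lemma tri1 : 1 = tri 1 0 1.
Proof.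
apply: val_inj; rewrite rmorph1 tri_val rmorph1.
by apply: matrix2P; rewrite mx2E !mxE.
Qed.

Lemma tri0 : 0 = tri 0 0 0.
Proof.
apply: val_inj; rewrite rmorph0 tri_val rmorph0.
by apply: matrix2P; rewrite mx2E !mxE.
Qed.

Lemma tri_idealE x y p : T (tri x y p) <-> x = 0.
Proof. by rewrite /triangular_ideal /= mx2E. Qed.

Local Notation E := (tri 1 0 0).
Local Notation A := (tri 0 1 0).

Lemma triEE : E * E = E.
Proof. by rewrite triM !(mulr1, mulr0, mul0r, addr0). Qed.

Lemma triE_neq0 : E <> 0.
Proof. by rewrite tri0 => /tri_inj[/eqP]; rewrite (negbTE (oner_neq0 _)). Qed.

Lemma tri_off_diagonal y : off_diagonal E (tri 0 y 0).
Proof.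
by split; rewrite triM ?rmorph0 !(mulr1, mulr0, mul0r, mul1r, addr0, add0r) -?tri0.
Qed.

Lemma triangular_idealE : T = right_annihilated E.
Proof.
apply/seteqP; split=> u; have [x [y [p ->]]] := tri_eta u.
  move=> /tri_idealE ->; rewrite /right_annihilated /= triM.
  by rewrite !(mulr1, mulr0, mul0r, addr0) -tri0.
rewrite /right_annihilated /= triM tri0 => /tri_inj[+ _ _].
by rewrite mulr1 => ->; exact/tri_idealE.
Qed.

Lemma triangular_left_ideal : left_ideals S T.
Proof. by rewrite triangular_idealE; exact: right_annihilated_left_ideal. Qed.

Lemma tri_unit_mem K x y p : left_ideals S K -> x != 0 -> K (tri x y p) ->
  exists y', K (tri 1 y' 0).
Proof.
move=> LK /Ddiv[x' [x'x _]] Ku; exists (x' * y).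
have -> : tri 1 (x' * y) 0 = tri x' 0 0 * tri x y p.
  by rewrite triM x'x !mul0r addr0.
exact: left_idealM.
Qed.

Lemma triangular_maximal : maximal_left_ideal T.
Proof.
split; first exact: triangular_left_ideal.
  move=> TT; have /tri_idealE/eqP : T E by rewrite TT.
  by rewrite (negbTE (oner_neq0 _)).
move=> J LJ TJ; have [JT|] := pselect (J `<=` T).
  by left; apply/seteqP; split.
move=> /existsNP[u /not_implyP[]]; have [x [y [p ->]]] := tri_eta u.
move=> Ju nTu; right; apply: left_ideal_setT => //.
have x0 : x != 0 by apply/eqP => x0; apply: nTu; exact/tri_idealE.
have [y' Jy'] := tri_unit_mem LJ x0 Ju.
have -> : 1 = tri 1 y' 0 + tri 0 (- y') 1.
  by rewrite triD addr0 subrr add0r -tri1.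
by apply: left_idealD => //; apply: TJ; exact/tri_idealE.
Qed.

Lemma triangular_ideal_neq0 : T <> [set 0].
Proof.
move=> T0; have : T A by exact/tri_idealE.
by rewrite T0 /= tri0 => /tri_inj[_ /eqP]; rewrite (negbTE (oner_neq0 _)).
Qed.

Lemma tri_line_mem K y : left_ideals S K -> K A -> K (tri 0 y 0).
Proof.
move=> LK KA; have -> : tri 0 y 0 = tri y 0 0 * A.
  by rewrite triM !(mulr0, mul0r, mulr1, addr0).
exact: left_idealM.
Qed.

Lemma meet_triangular_mem K : left_ideals S K -> T `&` K <> [set 0] -> K A.
Proof.
move=> LK TK; have [u [Tu Ku] u0] :=
  left_ideal_neq0 (left_ideal_cap triangular_left_ideal LK) TK.
have [x [y [p uE]]] := tri_eta u; subst u; have x0 := (tri_idealE _ _ _).1 Tu.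
subst x.
have line (z : D) : z != 0 -> K (tri 0 z 0) -> K A.
  move=> /Ddiv[z' [z'z _]] Kz.
  have -> : A = tri z' 0 0 * tri 0 z 0 by rewrite triM !(mulr0, mul0r, addr0) z'z.
  exact: left_idealM.
have [p0|p0] := eqVneq p 0; first subst p.
  by apply: (line y) => //; apply/eqP => y0; apply: u0; rewrite y0 tri0.
apply: (line (val p)).
  by apply: contraNneq p0 => /subring_val_eq0 ->.
have -> : tri 0 (val p) 0 = A * tri 0 y p by rewrite triM !(mulr0, mul0r, mul1r, add0r).
exact: left_idealM.
Qed.

Lemma tri_mem K x y p : left_ideals S K -> K A ->
  K (tri x y p) <-> K (tri 0 0 p) /\ (x = 0 \/ K E).
Proof.
move=> LK KA; have Kl y' := tri_line_mem y' LK KA.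
split=> [Ku|[Kp xE]]; last first.
  have -> : tri x y p = tri x 0 0 + tri 0 y p by rewrite triD !add0r addr0.
  apply: left_idealD => //.
    case: xE => [->|KE]; first by rewrite -tri0; exact: left_ideal0.
    have -> : tri x 0 0 = tri x 0 0 * E by rewrite triM !(mulr0, mul0r, mulr1, addr0).
    exact: left_idealM.
  have -> : tri 0 y p = tri 0 y 0 + tri 0 0 p by rewrite triD !add0r addr0.
  exact: left_idealD.
have Kxp : K (tri x 0 p).
  have -> : tri x 0 p = tri x y p - tri 0 y 0 by rewrite triB !subr0 subrr.
  exact: left_idealB.
have xE : x = 0 \/ K E.
  have [|x0] := eqVneq x 0; first by left.
  right; have [y' Ky'] := tri_unit_mem LK x0 Kxp.
  have -> : E = tri 1 y' 0 - tri 0 y' 0 by rewrite triB !subr0 subrr.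
  exact: left_idealB.
split=> //; case: xE => [x0|KE]; first by move: Kxp; rewrite x0.
have -> : tri 0 0 p = tri x 0 p - tri x 0 0 * E.
  by rewrite triM mulr1 !mulr0 ?mul0r addr0 triB !subr0 subrr.
by apply: left_idealB => //; exact: left_idealM.
Qed.

Definition lower_trace K : set (subring P) := [set p | K (tri 0 0 p)].

Lemma lower_trace_left_ideal K : left_ideals S K ->
  left_ideals (subring P) (lower_trace K).
Proof.
move=> LK; apply/left_idealsP; split; rewrite /lower_trace /=.
  by rewrite -tri0; exact: left_ideal0.
move=> a p q Kp Kq; have -> : tri 0 0 (a * p + q) = tri 0 0 a * tri 0 0 p + tri 0 0 q.
  by rewrite triM !(mulr0, mul0r, addr0) triD !addr0.
by apply: left_idealD => //; exact: left_idealM.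
Qed.

Lemma lower_trace_inj K L : left_ideals S K -> left_ideals S L -> K A -> L A ->
  (K E <-> L E) -> lower_trace K = lower_trace L -> K = L.
Proof.
move=> LK LL KA LA KLE QE.
have QEp p : K (tri 0 0 p) <-> L (tri 0 0 p).
  by rewrite -[K _]/(lower_trace K p) QE.
apply/seteqP; split=> u; have [x [y [p ->]]] := tri_eta u.
  by move/(tri_mem _ _ _ LK KA); rewrite QEp KLE; move/(tri_mem x y p LL LA).
by move/(tri_mem _ _ _ LL LA); rewrite -QEp -KLE; move/(tri_mem x y p LK KA).
Qed.

Lemma neighbours_triangular_mem K : neighbours T K -> left_ideals S K /\ K A.
Proof. by move=> [[LK _ _] [_ TK]]; split=> //; exact: meet_triangular_mem. Qed.

Lemma card_le_neighbours_triangular_half (N : set (set S)) :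
  N `<=` neighbours T -> (forall K L, N K -> N L -> (K E <-> L E)) ->
  N #<= left_ideals (subring P).
Proof.
move=> NT NE; apply: (card_le_inj (f := lower_trace)).
  by move=> K /NT/neighbours_triangular_mem[LK _]; exact: lower_trace_left_ideal.
move=> K L NK NL; have [LK KA] := neighbours_triangular_mem (NT _ NK).
have [LL LA] := neighbours_triangular_mem (NT _ NL).
by apply: lower_trace_inj => //; exact: NE.
Qed.

Lemma infinite_not_card_le_neighbours_triangular :
  triangular_data P -> ~ ([set: D] #<= neighbours T).
Proof.
move=> [[_ Dinf] [_ DP]] DN.
pose N1 := neighbours T `&` [set K | K E].
pose N2 := neighbours T `&` [set K | ~ K E].
have N12 : neighbours T `<=` N1 `|` N2.
  by move=> K NK; have [KE|KE] := pselect (K E); [left|right].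
have N1P : N1 #<= left_ideals (subring P).
  by apply: card_le_neighbours_triangular_half => [K []//|K L [_ KE] [_ LE]].
have N2P : N2 #<= left_ideals (subring P).
  by apply: card_le_neighbours_triangular_half => [K []//|K L [_ KE] [_ LE]].
have [finP|infP] := pselect (finite_set (left_ideals (subring P))).
  apply: Dinf; apply: card_le_finite DN _; apply: (sub_finite_set N12).
  by rewrite finite_setU; split; [apply: card_le_finite N1P _|apply: card_le_finite N2P _].
apply: DP; apply: card_le_trans DN _.
apply: card_le_trans (subset_card_le N12) _.
exact: card_le_setU.
Qed.

Lemma card_le_graph_triangular : [set: D] #<= graph_vertices S.
Proof.
apply: (card_le_inj (f := fun y => twist E [set 0] (tri 0 y 0))).
  move=> y _; apply: twist0_graph_vertices.
  - exact: triEE.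
  - exact: triE_neq0.
  - by rewrite -triangular_idealE; exact: triangular_ideal_neq0.
  - exact: tri_off_diagonal.
have L0 := left_ideal_set0 S.
have LT : [set 0] `<=` right_annihilated E.
  by move=> x ->; apply: left_ideal0; exact: right_annihilated_left_ideal.
move=> y y' _ _ /(twist_inj triEE L0 L0 LT LT (tri_off_diagonal _) (tri_off_diagonal _)).
by move=> [_ /eqP]; rewrite subr_eq0 => /eqP/tri_inj[].
Qed.

Lemma triangular_graph_infinite : infinite_set [set: D] ->
  infinite_set (graph_vertices S).
Proof.
move=> Dinf Gfin; apply: Dinf.
exact: card_le_finite card_le_graph_triangular Gfin.
Qed.

Lemma triangular_small_degree : triangular_data P -> small_degree T.
Proof.
move=> data; split; first by apply: subset_card_le => K [].
move=> GN; apply: (infinite_not_card_le_neighbours_triangular data).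
exact: card_le_trans card_le_graph_triangular GN.
Qed.

Definition first_row : set S := [set u | (\val u : 'M[D]_2) 1 1 = 0].

Lemma first_rowE x y p : first_row (tri x y p) <-> p = 0.
Proof.
rewrite /first_row /= mx2E; by split=> [/subring_val_eq0|->].
Qed.

Lemma first_row_left_ideal : left_ideals S first_row.
Proof.
apply/left_idealsP; split; first by rewrite tri0; exact/first_rowE.
move=> a u v; have [x [y [p ->]]] := tri_eta u; have [x' [y' [p' ->]]] := tri_eta v.
have [x3 [y3 [p3 ->]]] := tri_eta a => /first_rowE -> /first_rowE ->.
by rewrite triM triD; apply/first_rowE; rewrite mulr0 addr0.
Qed.

Lemma triangular_small_degree_unique (T' : set S) :
  infinite_set [set: D] -> maximal_left_ideal T' -> small_degree T' -> T' = T.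
Proof.
move=> Dinf [LT' T'T T'max] [_ nGN]; apply: contrapT => T'nT.
have [TT TnT _] := triangular_maximal.
have [x [y [p [x0 T'u]]]] : exists x y p, x != 0 /\ T' (tri x y p).
  apply: contrapT => nex; have T'sub : T' `<=` T.
    move=> u; have [x [y [p ->]]] := tri_eta u => T'u.
    apply/tri_idealE/eqP; apply: contraT => x0; exfalso; apply: nex.
    by exists x, y, p.
  by have [/esym|] := T'max _ TT T'sub.
have T'A : T' A.
  apply: contrapT => nT'A.
  have TT' : T `&` T' = [set 0].
    by apply: contrapT => TT'; apply: nT'A; exact: meet_triangular_mem.
  have T'J : T' `<=` first_row.
    move=> u; have [x1 [y1 [p1 ->]]] := tri_eta u => T'u1.
    apply/first_rowE.
    have : (T `&` T') (A * tri x1 y1 p1).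
      split; last exact: left_idealM.
      by rewrite triM !mul0r; exact/tri_idealE.
    rewrite TT' /= triM tri0 => /tri_inj[_ + _].
    by rewrite mul0r mul1r add0r => /subring_val_eq0.
  have [FT'|FT'] := T'max _ first_row_left_ideal T'J.
    by apply: nT'A; rewrite -FT'; exact/first_rowE.
  have /first_rowE/eqP : first_row (tri 1 0 1) by rewrite FT'.
  by rewrite (negbTE (oner_neq0 _)).
have T'E : T' E.
  by have [_ [x00|//]] := (tri_mem _ _ _ LT' T'A).1 T'u; rewrite x00 eqxx in x0.
have meet K : left_ideals S K -> K <> [set 0] -> T' `&` K <> [set 0].
  move=> LK K0 T'K; have [u Ku u0] := left_ideal_neq0 LK K0; apply: u0.
  have [x1 [y1 [p1 uE]]] := tri_eta u; subst u.
  have zero v : T' v -> K v -> v = 0.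
    by move=> T'v Kv; have : (T' `&` K) v by []; rewrite T'K.
  have T'xy x' y' : T' (tri x' y' 0).
    apply/(tri_mem _ _ _ LT' T'A); rewrite -tri0.
    by split; [exact: left_ideal0|right].
  have EuE : E * tri x1 y1 p1 = tri x1 y1 0.
    by rewrite triM !mul1r !mul0r addr0.
  have AuE : A * tri x1 y1 p1 = tri 0 (val p1) 0.
    by rewrite triM !mul1r !mul0r add0r.
  have := zero (E * tri x1 y1 p1); rewrite EuE => /(_ (T'xy _ _)).
  rewrite -EuE => /(_ (left_idealM _ LK Ku)); rewrite EuE tri0 => /tri_inj[-> -> _].
  have := zero (A * tri x1 y1 p1); rewrite AuE => /(_ (T'xy _ _)).
  rewrite -AuE => /(_ (left_idealM _ LK Ku)); rewrite AuE tri0 => /tri_inj[_ + _].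
  by move/subring_val_eq0 ->.
have GN : graph_vertices S `<=` neighbours T' `|` [set T'].
  move=> K GK; have [->|T'nK] := pselect (T' = K); first by right.
  by left; split=> //; split=> //; have [LK K0 _] := GK; exact: meet.
have Ginf := triangular_graph_infinite Dinf.
apply: nGN; apply: card_le_trans (subset_card_le GN) _.
have Ninf : infinite_set (neighbours T').
  move=> Nfin; apply: Ginf; apply: (sub_finite_set GN).
  by rewrite finite_setU; split=> //; exact: finite_set1.
apply: card_le_setU => //.
apply: card_le_trans (finite_set_countable (finite_set1 _)) _.
exact/infiniteP.
Qed.

Definition column_ideal (Q : set (subring P)) : set S :=
  [set u | exists y p, Q p /\ u = tri 0 y p].

Lemma column_idealE Q x y p : column_ideal Q (tri x y p) <-> x = 0 /\ Q p.
Proof.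
split=> [[y' [p' [Qp /tri_inj[-> _ ->]]]]//|[-> Qp]].
by exists y, p.
Qed.

Lemma column_left_ideal Q : left_ideals (subring P) Q -> left_ideals S (column_ideal Q).
Proof.
move=> LQ; apply/left_idealsP; split.
  by rewrite tri0; apply/column_idealE; split=> //; exact: left_ideal0.
move=> a u v [y [p [Qp ->]]] [y' [p' [Qp' ->]]]; have [x3 [y3 [p3 ->]]] := tri_eta a.
rewrite triM triD; apply/column_idealE; rewrite mulr0 addr0; split=> //.
by apply: left_idealD => //; exact: left_idealM.
Qed.

Lemma neighbours_triangular_intro K : left_ideals S K -> K A -> K <> T -> K <> setT ->
  neighbours T K.
Proof.
move=> LK KA KT KS; have A0 : A <> 0.
  by rewrite tri0 => /tri_inj[_ /eqP]; rewrite (negbTE (oner_neq0 _)).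
split; first by split=> // K0; apply: A0; move: KA; rewrite K0.
split; first by move=> TK; apply: KT.
by move=> TK; apply: A0; have : (T `&` K) A; [split=> //; exact/tri_idealE|rewrite TK].
Qed.

Lemma neighbours_first_row : neighbours T first_row.
Proof.
apply: neighbours_triangular_intro; first exact: first_row_left_ideal.
- exact/first_rowE.
- move=> FT; have /tri_idealE/eqP : T E by rewrite -FT; exact/first_rowE.
  by rewrite (negbTE (oner_neq0 _)).
- move=> FT; have /first_rowE/eqP : first_row (tri 0 0 1) by rewrite FT.
  by rewrite (negbTE (oner_neq0 _)).
Qed.

Lemma neighbours_column_ideal Q : left_ideals (subring P) Q -> Q <> setT ->
  neighbours T (column_ideal Q).
Proof.
move=> LQ QT; apply: neighbours_triangular_intro; first exact: column_left_ideal.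
- by apply/column_idealE; split=> //; exact: left_ideal0.
- move=> CT; apply: QT; apply/seteqP; split=> // p _.
  have /column_idealE[] : column_ideal Q (tri 0 0 p) by rewrite CT; exact/tri_idealE.
  by [].
- move=> CT; have /column_idealE[/eqP] : column_ideal Q E by rewrite CT.
  by rewrite (negbTE (oner_neq0 _)).
Qed.

Lemma card_left_ideals_le_neighbours_triangular :
  left_ideals (subring P) #<= neighbours T.
Proof.
apply: (card_le_inj (f := fun Q => if `[< Q = setT >] then first_row else column_ideal Q)).
  move=> Q LQ; case: asboolP => [_|QT]; first exact: neighbours_first_row.
  exact: neighbours_column_ideal.
have FC Q : first_row <> column_ideal Q.
  move=> FC; have : first_row E by exact/first_rowE.
  by rewrite FC => /column_idealE[/eqP]; rewrite (negbTE (oner_neq0 _)).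
move=> Q Q' _ _; case: asboolP => [->|_]; case: asboolP => [->|_] //.
- by move=> /FC.
- by move=> /esym/FC.
move=> CC; have CCp p : Q p <-> Q' p.
  have CQ (X : set (subring P)) : X p <-> column_ideal X (tri 0 0 p).
    by split=> [Xp|/column_idealE[]//]; exact/column_idealE.
  by rewrite CQ CC -CQ.
by apply/seteqP; split=> p /CCp.
Qed.

End TriangularRing.

(** * Classification *)

Lemma card_set2 T (x y : T) : x <> y -> [set x; y] #= `I_2.
Proof.
move=> xy; apply/card_eqPle; split.
  apply: (card_le_inj (f := fun z => if `[< z = x >] then 0%N else 1%N)).
    by move=> z _; case: asboolP.
  by move=> z z' [->|->] [->|->] //; case: asboolP => ?; case: asboolP => ?; congruence.
apply: (card_le_inj (f := fun n => if n == 0%N then x else y)).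
  by move=> [|n] _; [left|right].
by move=> [|[|m]] [|[|n]] //= _ _ => eq; case: xy.
Qed.

Section TriangularDivision.
Variables (D : nzRingType) (P : subringClosed D).
Hypothesis Ddiv : division_ring D.
Local Notation S := (triangular_ring P).
Local Notation T := (triangular_ideal P).
Local Notation E := (tri 1 0 (0 : subring P)).

Lemma neighbours_triangular_division : division_ring (subring P) ->
  neighbours T = [set column_ideal [set 0]; first_row (P := P)].
Proof.
move=> Pdiv; have L0 := left_ideal_set0 (subring P).
apply/seteqP; split=> K; last first.
  move=> [->|->]; last exact: neighbours_first_row.
  apply: neighbours_column_ideal => // P0.
  have /eqP : [set 0] (1 : subring P) by rewrite P0.
  by rewrite (negbTE (oner_neq0 _)).
move=> NK; have [LK KA] := neighbours_triangular_mem Ddiv NK.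
have [[_ _ KS] [KT _]] := NK.
have [trK|trK] := pselect (lower_trace K = [set 0]).
  have [KE|KE] := pselect (K E); [right|left];
    apply: lower_trace_inj => //; rewrite ?trK.
  - exact: first_row_left_ideal.
  - exact/first_rowE.
  - by split=> // _; exact/first_rowE.
  - by apply/seteqP; split=> p; rewrite /lower_trace /=; move/first_rowE.
  - exact: column_left_ideal.
  - exact/column_idealE.
  - by split=> // /column_idealE[/eqP]; rewrite (negbTE (oner_neq0 _)).
  - apply/seteqP; split=> p; rewrite /lower_trace /=; last by move=> /column_idealE[].
    by move=> ->; exact/column_idealE.
have [p Kp p0] := left_ideal_neq0 (lower_trace_left_ideal LK) trK.
have [q [qp _]] : exists q, q * p = 1 /\ p * q = 1 by apply: Pdiv; exact/eqP.
have trKT : lower_trace K = setT.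
  apply: left_ideal_setT; first exact: lower_trace_left_ideal.
  by rewrite -qp; apply: left_idealM => //; exact: lower_trace_left_ideal.
have [KE|KE] := pselect (K E).
  case: KS; apply: left_ideal_setT => //; rewrite tri1; apply/tri_mem => //.
  by split; [rewrite -[K _]/(lower_trace K 1) trKT|right].
case: KT; symmetry; apply: lower_trace_inj => //.
- exact: triangular_left_ideal.
- exact/tri_idealE.
- by split=> // /tri_idealE/eqP; rewrite (negbTE (oner_neq0 _)).
- by rewrite trKT; apply/seteqP; split=> // r _; exact/tri_idealE.
Qed.

Lemma card_neighbours_triangular_division : division_ring (subring P) ->
  neighbours T #= `I_2.
Proof.
move=> /neighbours_triangular_division ->; apply: card_set2 => CF.
have : first_row (P := P) E by exact/first_rowE.
by rewrite -CF => /column_idealE[/eqP]; rewrite (negbTE (oner_neq0 _)).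
Qed.

(* Two of the left ideals P x^n coincide, and cancelling a power of x in D yields
   a left inverse of x in P. *)
Lemma finite_left_ideals_division :
  finite_set (left_ideals (subring P)) -> division_ring (subring P).
Proof.
move=> finP x x0.
have vx0 : val x != 0 by apply: contra_neq x0 => /subring_val_eq0.
have [w [wx xw]] := Ddiv vx0.
suff [z zx] : exists z, z * x = 1.
  exists z; split=> //; apply: val_inj; rewrite rmorphM rmorph1 /=.
  have -> : val z = w by rewrite -[LHS]mulr1 -xw mulrA -rmorphM zx rmorph1 mul1r.
  exact: xw.
have [m [n [mn mnE]]] : exists m n, (m < n)%N /\ principal (x ^+ m) = principal (x ^+ n).
  apply: contrapT => nmn; have : [set: nat] #<= left_ideals (subring P).
    apply: (card_le_inj (f := fun n => principal (x ^+ n))).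
      by move=> n _; exact: principal_left_ideal.
    move=> m n _ _ mnE; have [mn|nm|//] := ltngtP m n; exfalso; apply: nmn.
      by exists m, n.
    by exists n, m.
  by move/infiniteP; exact.
have : principal (x ^+ n) (x ^+ m) by rewrite -mnE; exact: principal_id.
move=> [y xE]; exists (y * x ^+ (n - m).-1); apply: val_inj.
have ww k : val x ^+ k * w ^+ k = 1.
  elim: k => [|k IH]; first by rewrite !expr0 mulr1.
  by rewrite exprS exprSr -mulrA (mulrA (_ ^+ _)) IH mul1r.
have xE' : y * x ^+ (n - m).-1 * x * x ^+ m = x ^+ m.
  rewrite -[y * _ * x]mulrA -exprSr prednK ?subn_gt0 // -mulrA -exprD.
  by rewrite subnK ?(ltnW mn).
by rewrite rmorph1 -[LHS]mulr1 -(ww m) mulrA -rmorphXn -rmorphM xE' rmorphXn.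
Qed.

Lemma finite_neighbours_triangular_division :
  finite_set (neighbours T) -> division_ring (subring P).
Proof.
move=> finN; apply: finite_left_ideals_division.
exact: card_le_finite (card_left_ideals_le_neighbours_triangular P) finN.
Qed.

End TriangularDivision.

Lemma small_degree_classification (R : pzRingType) (T : set R) :
  infinite_set (graph_vertices R) -> maximal_left_ideal T -> small_degree T ->
  (exists D : nzRingType, infinite_division_ring D /\ ring_isomorphic R 'M[D]_2) \/
  (exists (D : nzRingType) (P : subringClosed D),
      triangular_data P /\ ring_isomorphic R (triangular_ring P)).
Proof.
move=> Ginf Tmax Tsmall.
have [e [ee e0 TE Vinf [NV nVN]]] := small_degree_off_diagonal Ginf Tmax Tsmall.
subst T; set T := right_annihilated e in Tmax NV nVN *.
have [a Va a0] : exists2 a, off_diagonal e a & a <> 0.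
  apply: contrapT => na; apply: Vinf; apply: (sub_finite_set (B := [set 0])).
    by move=> c Vc; apply: contrapT => c0; apply: na; exists c.
  exact: finite_set1.
have [ea ae] := Va.
have a_span c : off_diagonal e c -> exists2 d, peirce_corner e d & c = d * a.
  exact: (off_diagonal_line ee e0 Tmax nVN Va a0).
have a_free d : peirce_corner e d -> d * a = 0 -> d = 0.
  exact: (corner_mul_eq0 ee Tmax Va a0).
have Ddiv : division_ring (corner ee e0) := corner_division Tmax.
have Dinf : infinite_set [set: corner ee e0] := corner_infinite Vinf a_span.
have [aT|aT] := pselect (principal a = T).
  left; exists (corner ee e0); split=> //.
  have [x0 xa] : principal a (1 - e).
    by rewrite aT /T/= /right_annihilated/= mulrBl mul1r ee subrr.
  pose x := (1 - e) * x0 * e.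
  have ex : e * x = 0 by rewrite /x !mulrA mulrBr mulr1 ee subrr !mul0r.
  have xe : x * e = x by rewrite /x -!mulrA ee.
  have xaE : x * a = 1 - e.
    rewrite /x -mulrA ea -mulrA -xa mulrBr mulr1 mulrBl mul1r ee subrr.
    by rewrite subr0.
  apply: (matrix_units_isomorphic ee e0 ea ae ex xe _ xaE).
  apply/eqP; rewrite -subr_eq0; apply/eqP/a_free.
    apply: peirce_cornerB => //.
    by split; [rewrite mulrA ea|rewrite -(mulrA a x) xe].
  by rewrite mulrBl -mulrA xaE mulrBr mulr1 ae subr0 ea subrr.
right; exists (corner ee e0), (line_action Va : subringClosed (corner ee e0)).
have [f fbij TE] := triangular_isomorphic ee e0 Va a_free a_span
  (fun r => lower_corner0 ee e0 Tmax nVN r Va a0 aT)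
  (fun s => faithful_corner ee e0 Tmax nVN Va a0 (s := s)).
split; last by exists f.
set P : subringClosed (corner ee e0) := line_action Va in f fbij TE *.
have VD : off_diagonal e #<= [set: corner ee e0].
  apply/card_le_relP; exists (fun c d => c = val d * a); split.
    by move=> c /a_span[d Dd ->]; exists (corner_in ee e0 Dd).
  by move=> c c' d _ _ -> ->.
have DV : [set: corner ee e0] #<= off_diagonal e.
  apply: (card_le_inj (f := fun d : corner ee e0 => val d * a)).
    by move=> d _; apply: peirce_corner_off_diagonal => //; exact: corner_valP.
  move=> d d' _ _ dd'; apply/val_inj/eqP; rewrite -subr_eq0; apply/eqP/a_free.
    by apply: peirce_cornerB; exact: corner_valP.
  by rewrite mulrBl dd' subrr.
have PN : left_ideals (subring P) #<= neighbours T.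
  rewrite /T TE (card_le_eqr (card_neighbours_preim fbij _)).
  exact: card_left_ideals_le_neighbours_triangular.
split=> //; split.
  by apply: card_le_trans VD; apply: card_le_trans NV.
by move=> DP; apply: nVN; apply: card_le_trans PN; apply: card_le_trans DP.
Qed.

Lemma finite_neighbours_small_degree (R : pzRingType) (T : set R) :
  infinite_set (graph_vertices R) -> finite_set (neighbours T) -> small_degree T.
Proof.
move=> Ginf finN; split; first by apply: subset_card_le => K [].
by move=> GN; apply: Ginf; exact: card_le_finite GN finN.
Qed.

Section MatrixIso.
Variables (R : pzRingType) (D : nzRingType).
Hypotheses (Ddiv : infinite_division_ring D) (Riso : ring_isomorphic R 'M[D]_2).

Lemma matrix_iso_graph_infinite : infinite_set (graph_vertices R).
Proof.
have [[Dd Dinf] [f fbij]] := (Ddiv, Riso).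
apply/(infinite_graph_vertices_preim fbij); exact: matrix_graph_infinite.
Qed.

Lemma matrix_iso_no_edge (K L : set R) : graph_vertices R K -> graph_vertices R L ->
  K `&` L <> [set 0] -> K = L.
Proof.
have [[Dd Dinf] [f fbij]] := (Ddiv, Riso).
have [K' ->] := preim_bij_surj fbij K; have [L' ->] := preim_bij_surj fbij L.
move=> /(preim_graph_vertices fbij) GK /(preim_graph_vertices fbij) GL KL.
congr preimage; apply: (matrix_graph_no_edge Dd) => // KL0; apply: KL.
by rewrite -preimage_setI KL0 preim_set0.
Qed.

Lemma matrix_iso_neighbours (T : set R) : graph_vertices R T -> neighbours T = set0.
Proof.
move=> GT; apply/seteqP; split=> // K [GK [TK /matrix_iso_no_edge]].
by move=> /(_ GT GK).
Qed.

Lemma matrix_iso_maximal (T : set R) :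
  maximal_left_ideal T /\ small_degree T <-> graph_vertices R T.
Proof.
have G0 : graph_vertices R !=set0.
  exact: infinite_setN0 matrix_iso_graph_infinite.
split=> [[Tmax _]|GT].
  have [LT TT _] := Tmax; split=> //.
  exact: maximal_left_ideal_neq0 Tmax.
split; last exact/small_degree_set0/matrix_iso_neighbours.
by apply: graph_vertices_maximal => // K GK; exact: matrix_iso_no_edge.
Qed.

End MatrixIso.

Section TriangularIso.
Variables (R : pzRingType) (D : nzRingType) (P : subringClosed D).
Variable f : {rmorphism R -> triangular_ring P}.
Hypotheses (data : triangular_data P) (fbij : bijective f).

Lemma triangular_iso_graph_infinite : infinite_set (graph_vertices R).
Proof.
have [[Dd Dinf] _] := data.
by apply/(infinite_graph_vertices_preim fbij); exact: triangular_graph_infinite.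
Qed.

Lemma triangular_iso_maximal (T : set R) :
  maximal_left_ideal T /\ small_degree T <-> T = f @^-1` triangular_ideal P.
Proof.
have [[Dd Dinf] _] := data.
split=> [|->].
  have [T' ->] := preim_bij_surj fbij T.
  move=> [/(preim_maximal fbij) Tmax /(preim_small_degree fbij) Tsmall].
  by rewrite (triangular_small_degree_unique Dd Dinf Tmax Tsmall).
split; first by apply/(preim_maximal fbij); exact: triangular_maximal.
by apply/(preim_small_degree fbij); exact: triangular_small_degree.
Qed.

Lemma triangular_iso_finite (T : set R) :
  maximal_left_ideal T -> finite_set (neighbours T) ->
  T = f @^-1` triangular_ideal P.
Proof.
move=> Tmax finN; apply/triangular_iso_maximal; split=> //.
exact/finite_neighbours_small_degree/finN/triangular_iso_graph_infinite.
Qed.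

Lemma triangular_iso_card : division_ring (subring P) ->
  neighbours (f @^-1` triangular_ideal P) #= `I_2.
Proof.
have [[Dd Dinf] _] := data; move=> Pdiv.
apply: card_eq_trans (card_neighbours_preim fbij _) _.
exact: card_neighbours_triangular_division.
Qed.

End TriangularIso.

Theorem theorem3p2 (R : pzRingType) :
  [/\ (* the classification *)
      (infinite_set (graph_vertices R) /\
       exists T : set R, maximal_left_ideal T /\ small_degree T)
      <->
      ((exists D : nzRingType,
          infinite_division_ring D /\ ring_isomorphic R 'M[D]_2) \/
       (exists (D : nzRingType) (P : subringClosed D),
          triangular_data P /\ ring_isomorphic R (triangular_ring P))),
      (* the ideals T in the M_2(D) case *)
      (forall D : nzRingType,
         infinite_division_ring D -> ring_isomorphic R 'M[D]_2 ->
         forall T : set R,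
           (maximal_left_ideal T /\ small_degree T <-> graph_vertices R T) /\
           (graph_vertices R T -> neighbours T #= `I_0)),
      (* the ideal T in the triangular case *)
      (forall (D : nzRingType) (P : subringClosed D)
              (f : {rmorphism R -> triangular_ring P}),
         triangular_data P -> bijective f ->
         forall T : set R,
           maximal_left_ideal T /\ small_degree T <->
           T = f @^-1` triangular_ideal P),
      (* maximal left ideals of finite degree *)
      ((exists T : set R, maximal_left_ideal T /\ finite_set (neighbours T)) /\
       infinite_set (graph_vertices R))
      <->
      ((exists D : nzRingType,
          infinite_division_ring D /\ ring_isomorphic R 'M[D]_2) \/
       (exists (D : nzRingType) (P : subringClosed D),
          [/\ triangular_data P, division_ring (subring P) &
              ring_isomorphic R (triangular_ring P)])) &
      (* the degree of such an ideal in the two cases *)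
      (forall D : nzRingType,
         infinite_division_ring D -> ring_isomorphic R 'M[D]_2 ->
         forall T : set R,
           maximal_left_ideal T -> finite_set (neighbours T) ->
           neighbours T #= `I_0) /\
      (forall (D : nzRingType) (P : subringClosed D),
         triangular_data P -> division_ring (subring P) ->
         ring_isomorphic R (triangular_ring P) ->
         forall T : set R,
           maximal_left_ideal T -> finite_set (neighbours T) ->
           neighbours T #= `I_2)].
Proof.
have forward T : infinite_set (graph_vertices R) -> maximal_left_ideal T ->
  small_degree T -> _ := @small_degree_classification R T.
split.
- split=> [[Ginf [T [Tmax Tsmall]]]|]; first exact: forward Tsmall.
  case=> [[D [Ddiv Riso]]|[D [P [data [f fbij]]]]].
    have Ginf := matrix_iso_graph_infinite Ddiv Riso.
    have [T GT] := infinite_setN0 Ginf.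
    by split=> //; exists T; exact/(matrix_iso_maximal Ddiv Riso).
  split; first exact: triangular_iso_graph_infinite fbij.
  by exists (f @^-1` triangular_ideal P); exact/(triangular_iso_maximal data fbij).
- move=> D Ddiv Riso T; split; first exact: matrix_iso_maximal Riso T.
  move=> /(matrix_iso_neighbours Ddiv Riso) ->; rewrite II0.
  exact: card_eq00.
- by move=> D P f data fbij T; exact: triangular_iso_maximal.
- split=> [[[T [Tmax finN]] Ginf]|].
    have Tsmall := finite_neighbours_small_degree Ginf finN.
    have [|[D [P [data [f fbij]]]]] := forward T Ginf Tmax Tsmall; first by left.
    right; exists D, P; split=> //; last by exists f.
    have TE := triangular_iso_finite data fbij Tmax finN.
    have [[Ddiv _] _] := data.
    apply: finite_neighbours_triangular_division => //.
    by rewrite -(eq_finite_set (card_neighbours_preim fbij _)) -TE.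
  case=> [[D [Ddiv Riso]]|[D [P [data Pdiv [f fbij]]]]].
    have Ginf := matrix_iso_graph_infinite Ddiv Riso.
    have [T GT] := infinite_setN0 Ginf.
    split=> //; exists T; split; first by have [] := (matrix_iso_maximal Ddiv Riso T).2 GT.
    by rewrite (matrix_iso_neighbours Ddiv Riso GT); exact: finite_set0.
  split; last exact: triangular_iso_graph_infinite fbij.
  exists (f @^-1` triangular_ideal P); split.
    by have [] := (triangular_iso_maximal data fbij _).2 erefl.
  by apply/finite_setP; exists 2%N; exact: triangular_iso_card.
split=> [D Ddiv Riso T Tmax finN|D P data Pdiv [f fbij] T Tmax finN].
  have Ginf := matrix_iso_graph_infinite Ddiv Riso.
  have /(matrix_iso_maximal Ddiv Riso) GT :
    maximal_left_ideal T /\ small_degree T.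
    by split=> //; exact: finite_neighbours_small_degree.
  by rewrite (matrix_iso_neighbours Ddiv Riso GT) II0; exact: card_eq00.
rewrite (triangular_iso_finite data fbij Tmax finN).
exact: triangular_iso_card.
Qed.
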